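(* Let $n\ge 2$, $m\ge 1$, let $(\boldsymbol{U}_A^{(i)},\Gamma^{(i)})_{1\le i\le n}$ be an i.i.d. sample of $(\boldsymbol{U}_A,\Gamma)$, and let $\boldsymbol{X}^{(1)},\dots,\boldsymbol{X}^{(m)}$ be an i.i.d. sample of $\boldsymbol{X}\sim\mathrm{Unif}(\mathcal{X})$, independent of the first sample. Define $$\widehat{\widehat{\operatorname{HSIC}}}(\boldsymbol{U}_A,\Gamma)=\frac{2}{n(n-1)}\sum_{1\le i<j\le n}\left(K_A(\boldsymbol{U}_A^{(i)},\boldsymbol{U}_A^{(j)})-1\right)\exp\left(-\frac{\lambda(\mathcal{X})}{2\sigma^2}\,\frac1m\sum_{k=1}^m\mathbf{1}_{\Gamma^{(i)}\Delta\Gamma^{(j)}}(\boldsymbol{X}^{(k)})\right).$$ Then $$\mathbb{E}\left[\left(\widehat{\widehat{\operatorname{HSIC}}}(\boldsymbol{U}_A,\Gamma)-\operatorname{HSIC}(\boldsymbol{U}_A,\Gamma)\right)^2\right]\le 2\left(\frac{2\sigma_1^2}{n(n-1)}+\frac{4(n-2)\sigma_2^2}{n(n-1)}+\frac{L^2\sigma_3^2}{m}\right),$$ where, with $(\boldsymbol{U}_A',\Gamma')$ an independent copy of $(\boldsymbol{U}_A,\Gamma)$ and $\boldsymbol{X}\sim\mathrm{Unif}(\mathcal{X})$ independent of both, \begin{align*} \sigma_1^2&=\operatorname{Var}\left((K_A(\boldsymbol{U}_A,\boldsymbol{U}_A')-1)\,k_{set}(\Gamma,\Gamma')\right),\\ \sigma_2^2&=\operatorname{Var}\left(\mathbb{E}\left[(K_A(\boldsymbol{U}_A,\boldsymbol{U}_A')-1)\,k_{set}(\Gamma,\Gamma')\,\middle|\,(\Gamma,\boldsymbol{U}_A)\right]\right),\\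 \sigma_3^2&=\mathbb{E}\left[(K_A(\boldsymbol{U}_A,\boldsymbol{U}_A')-1)^2\operatorname{Var}\left(\mathbf{1}_{\Gamma\Delta\Gamma'}(\boldsymbol{X})\,\middle|\,(\boldsymbol{U}_A,\boldsymbol{U}_A',\Gamma,\Gamma')\right)\right],\\ L&=\frac{\lambda(\mathcal{X})}{2\sigma^2}. \end{align*}
   Context: **Sets.** $\mathcal{X}\subset\mathbb{R}^d$ is compact with Lebesgue measure $\lambda(\mathcal{X})>0$. $\mathscr{L}(\mathcal{X})$ is the collection of Lebesgue-measurable subsets of $\mathcal{X}$; $\gamma_1\Delta\gamma_2$ is the symmetric difference; $\delta(\gamma_1,\gamma_2)=\lambda(\gamma_1\Delta\gamma_2)$. $\mathscr{L}^*(\mathcal{X})$ is the quotient of $\mathscr{L}(\mathcal{X})$ by the relation $\delta(\gamma_1,\gamma_2)=0$, equipped with the metric $\delta$ and its Borel $\sigma$-algebra. For a fixed $\sigma>0$, $k_{set}(\gamma_1,\gamma_2)=\exp\left(-\lambda(\gamma_1\Delta\gamma_2)/(2\sigma^2)\right)$ on $\mathscr{L}^*(\mathcal{X})\times\mathscr{L}^*(\mathcal{X})$; it is a bounded measurable kernel. **Inputs and output.** $\boldsymbol{U}=(U_1,\dots,U_p)$ is a random vector with values in $\mathcal{U}=\mathcal{U}_1\times\dots\times\mathcal{U}_p\subset\mathbb{R}^p$ with mutually independent components, and $\Gamma=\eta(\boldsymbol{U})$ is a random set, where $\eta:\mathcal{U}\to\mathscr{L}^*(\mathcal{X})$ is Borel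 measurable. The indicators $\mathbf{1}_{\Gamma}(x)$ are evaluated through a jointly measurable version of $(x,\boldsymbol{u})\mapsto\mathbf{1}_{\eta(\boldsymbol{u})}(x)$. $A\subset\{1,\dots,p\}$ and $\boldsymbol{U}_A=(U_i)_{i\in A}$. **Input kernels.** A kernel is a symmetric function that is positive definite (all quadratic forms $\sum_{i,j}\alpha_i\alpha_jk(z_i,z_j)$ are $\geq 0$). Each input $U_i$ has a measurable ANOVA kernel $K_i$ on $\mathcal{U}_i$ with respect to its law $\mathbb{P}_{U_i}$, i.e. $K_i=1+k_i$ where $k_i$ is a kernel with $\int k_i(u,z)\,d\mathbb{P}_{U_i}(z)=0$ for all $u\in\mathcal{U}_i$. Set $K_A=\bigotimes_{i\in A}K_i$, i.e. $K_A(\boldsymbol{u},\boldsymbol{u}')=\prod_{i\in A}K_i(u_i,u_i')$, and assume $\mathbb{E}[K_A(\boldsymbol{U}_A,\boldsymbol{U}_A)]<+\infty$. **HSIC.** $\operatorname{HSIC}(\boldsymbol{U}_A,\Gamma)$ is the squared norm, in the reproducing kernel Hilbert space of $K_A\otimes k_{set}$, of the difference between the kernel mean embeddings of the joint law $\mathbb{P}_{\boldsymbol{U}_A,\Gamma}$ and of the product of marginals $\mathbb{P}_{\boldsymbol{U}_A}\otimes\mathbb{P}_\Gamma$ (the kernel mean embedding of a law $\mathbb{P}$ is $\int k(z,\cdot)\,d\mathbb{P}(z)$). Since the components of $\boldsymbol{U}$ are mutually independent, each $K_i$ is an ANOVA kernel with respect to $\mathbb{P}_{U_i}$, $\mathbb{E}[K_A(\boldsymbol{U}_A,\boldsymbol{U}_A)]<+\infty$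 and $k_{set}$ is bounded and measurable, $\operatorname{HSIC}(\boldsymbol{U}_A,\Gamma)$ equals $\mathbb{E}\left[(K_A(\boldsymbol{U}_A,\boldsymbol{U}_A')-1)\,k_{set}(\Gamma,\Gamma')\right]$, where $(\boldsymbol{U}_A',\Gamma')$ is an independent copy of $(\boldsymbol{U}_A,\Gamma)$. *)

(* Defs.v *)
From HB Require Import structures.
From mathcomp Require Import all_boot all_order all_algebra.
From mathcomp Require Import all_classical all_reals all_analysis.

Set Implicit Arguments.
Unset Strict Implicit.
Unset Printing Implicit Defensive.

Import Order.TTheory GRing.Theory Num.Theory.
Import numFieldTopology.Exports numFieldNormedType.Exports.

Local Open Scope classical_set_scope.
Local Open Scope ring_scope.

(* R^d is 'rV[R]_d.+1, so that the dimension is at least 1.  The outer        *)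
(* measure is the infimum of the total volume of countable covers by closed   *)
(* boxes; finite covers are obtained by padding with degenerate boxes.        *)
Section lebesgue_outer_measure.
Local Open Scope ereal_scope.
Context {R : realType} {d : nat}.
Implicit Types (a b : 'rV[R]_d.+1) (A : set 'rV[R]_d.+1).

Definition box (c : 'rV[R]_d.+1 * 'rV[R]_d.+1) : set 'rV[R]_d.+1 :=
  [set x | forall i, (c.1 ord0 i <= x ord0 i <= c.2 ord0 i)%R].

Definition proper_box (c : 'rV[R]_d.+1 * 'rV[R]_d.+1) : Prop :=
  forall i, (c.1 ord0 i <= c.2 ord0 i)%R.

Definition box_volume (c : 'rV[R]_d.+1 * 'rV[R]_d.+1) : \bar R :=
  (\prod_(i < d.+1) (c.2 ord0 i - c.1 ord0 i))%:E.

Definition box_cover A (c : nat -> 'rV[R]_d.+1 * 'rV[R]_d.+1) : Prop :=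
  (forall k, proper_box (c k)) /\ A `<=` \bigcup_k box (c k).

Definition leb A : \bar R :=
  ereal_inf [set \sum_(k <oo) box_volume (c k) | c in box_cover A].

Lemma box_volume_ge0 c : proper_box c -> 0 <= box_volume c.
Proof. by move=> pc; rewrite lee_fin prodr_ge0// => i _; rewrite subr_ge0. Qed.

Lemma leb_ge0 A : 0 <= leb A.
Proof.
apply: le_ereal_inf_tmp => _ [c [pc _] <-].
by apply: nneseries_ge0 => k _ _; exact: box_volume_ge0.
Qed.

Lemma leb0 : leb set0 = 0.
Proof.
apply/eqP; rewrite eq_le leb_ge0 andbT.
apply: ereal_inf_lbound; exists (fun=> (0, 0)%R).
  by split => // k i; exact: lexx.
rewrite eseries0// => k _ _.
by rewrite /box_volume/= (bigD1 ord0)//= subrr mul0r.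
Qed.

Lemma le_leb : {homo leb : A B / A `<=` B >-> A <= B}.
Proof.
move=> A B AB; apply/ereal_inf_le_tmp => _ [c [pc Bc] <-].
by exists c => //; split => //; exact: subset_trans AB Bc.
Qed.

Lemma leb_sigma_subadditive : sigma_subadditive leb.
Proof.
move=> A; have [[i ioo]|] := pselect (exists i, leb (A i) = +oo).
  rewrite (eseries_pinfty _ _ ioo) ?leey// => n _.
  by rewrite -ltNye (lt_le_trans _ (leb_ge0 _)).
rewrite -forallNE => Aoo.
suff add2e (e : {posnum R}) :
    leb (\bigcup_n A n) <= \sum_(i <oo) leb (A i) + e%:num%:E.
  by apply/lee_addgt0Pr => _/posnumP[].
rewrite (le_trans _ (epsilon_trick _ _ _))//; last by move=> n; exact: leb_ge0.
pose Q n c := box_cover (A n) c /\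
  \sum_(k <oo) box_volume (c k) <= leb (A n) + (e%:num / (2 ^ n.+1)%:R)%:E.
have [G QG] : {G & forall n, Q n (G n)}.
  apply: (@choice _ _ Q) => n.
  have ln : leb (A n) \is a fin_num.
    by rewrite ge0_fin_numE ?leb_ge0// ltey; exact/eqP/Aoo.
  have en1 : (0 < e%:num / (2 ^ n.+1)%:R)%R by [].
  have [_ [c Ac <-] lec] := lb_ereal_inf_adherent en1 ln.
  by exists c; split => //; exact/ltW.
have G_ge0 x : 0 <= (box_volume \o uncurry G) x.
  by case: x => n k; apply: box_volume_ge0; exact: (QG n).1.1.
apply: (@le_trans _ _ (\esum_(i in setT) (box_volume \o uncurry G) i)).
  apply: ereal_inf_lbound => /=.
  have /card_esym/ppcard_eqP[f] := card_nat2.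
  exists (uncurry G \o f).
    split => [i|x [n _ Anx]]; first by rewrite /=; case: (f i) => n k; exact: (QG n).1.1.
    have [k _ Gx] := (QG n).1.2 _ Anx.
    by exists (f^-1%FUN (n, k)) => //=; rewrite invK ?inE.
  by rewrite -(esum_pred_image (box_volume \o uncurry G) _ xpredT)
    ?[fun=> _]set_true// image_eq.
rewrite (_ : esum _ _ = \sum_(i <oo) \sum_(j <oo) box_volume (G i j)); last first.
  pose J : nat -> set (nat * nat) := fun i => [set (i, j) | j in setT].
  rewrite (_ : setT = \bigcup_k J k); last first.
    by rewrite predeqE => -[a b]; split => // _; exists a => //; exists b.
  rewrite esum_bigcupT /=; last 2 first.
    - apply/trivIsetP => i j _ _ ij.
      rewrite predeqE => -[n m] /=; split => //= -[] [_] _ [<-{n} _].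
      by move=> [m' _] [] /esym/eqP; rewrite (negbTE ij).
    - by move=> [n m]; exact: (G_ge0 (n, m)).
  rewrite -(image_id [set: nat]) -fun_true esum_pred_image//; last first.
    by move=> n _; apply: esum_ge0 => x _; exact: G_ge0.
  apply: eq_eseriesr => /= j _.
  rewrite -(esum_pred_image (box_volume \o uncurry G) (pair j) predT)//=.
  - by congr esum; rewrite predeqE => -[a b]; split; move=> [i _ <-]; exists i.
  - by move=> k _; exact: (G_ge0 (j, k)).
  - by move=> ? ? _ _; exact: (@can_inj _ _ _ snd).
apply: lee_nneseries => [i _ _|i _]; last exact: (QG i).2.
by apply: nneseries_ge0 => j _ _; exact: (G_ge0 (i, j)).
Qed.

HB.instance Definition _ := isOuterMeasure.Build R 'rV[R]_d.+1 leb
  leb0 leb_ge0 le_leb leb_sigma_subadditive.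

End lebesgue_outer_measure.

Definition borel_rV (R : realType) (d : nat) :=
  g_sigma_algebraType (@open 'rV[R]_d.+1).

Section measurable_set_classes.
Context {R : realType} {d : nat} (X : set 'rV[R]_d.+1).

Definition Lsets : set (set 'rV[R]_d.+1) :=
  [set A | leb.-caratheodory A /\ A `<=` X].

Definition Lset : Type := {A : set 'rV[R]_d.+1 | A \in Lsets}.
HB.instance Definition _ := Choice.on Lset.

Definition ae_eq_set : rel Lset := fun A B => leb (val A `+` val B) == 0%E.

Lemma ae_eq_set_refl : reflexive ae_eq_set.
Proof. by move=> A; rewrite /ae_eq_set setYK leb0. Qed.

Lemma ae_eq_set_sym : symmetric ae_eq_set.
Proof. by move=> A B; rewrite /ae_eq_set setYC. Qed.

Lemma ae_eq_set_trans : transitive ae_eq_set.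
Proof.
move=> B A C /eqP AB /eqP BC; apply/eqP/le_anti; rewrite leb_ge0 andbT.
have -> : 0%E = (leb (val A `+` val B) + leb (val B `+` val C))%E.
  by rewrite AB BC adde0.
apply: le_trans (outer_measureU2 _ _ _); apply: le_leb => x /=.
by have [Bx|Bx] := pselect (sval B x); tauto.
Qed.

Canonical ae_eq_set_equiv :=
  EquivRel ae_eq_set ae_eq_set_refl ae_eq_set_sym ae_eq_set_trans.

Definition Lstar_quot : Type := {eq_quot ae_eq_set}%qT.
HB.instance Definition _ := Quotient.on Lstar_quot.
HB.instance Definition _ := Choice.on Lstar_quot.

Lemma Lsets0 : set0 \in Lsets.
Proof. by rewrite inE; split=> //; exact: caratheodory_measurable_set0. Qed.

HB.instance Definition _ := isPointed.Build Lstar_quot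
  (\pi_Lstar_quot (exist _ set0 Lsets0 : Lset))%qT.

(* The value does not depend on the representatives chosen by repr. It is the *)
(* actual distance when X has finite measure, in particular when X is compact.*)
Definition delta (g1 g2 : Lstar_quot) : R :=
  fine (leb (val (repr g1) `+` val (repr g2))).

Definition delta_open : set (set Lstar_quot) :=
  [set O | forall g, O g ->
     exists2 e : R, 0 < e & forall g', delta g g' < e -> O g'].

Definition Lstar := g_sigma_algebraType delta_open.

Definition Lclass (A : Lset) : Lstar := (\pi_Lstar_quot A)%qT.

Definition kset (sigma : R) (g1 g2 : Lstar) : R :=
  expR (- (delta g1 g2 / (2 * sigma ^+ 2))).

End measurable_set_classes.

(* A subset of R with the trace of the Borel sigma-algebra.  It need not be   *)
(* Borel; nonemptiness makes it a pointedType, as required of measurableType, *)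
(* and holds for the range space of any random variable.                      *)
Section domain.
Context {R : realType} (D : set R).

Definition pointed_subset of D !=set0 : Type := {x : R | x \in D}.

Variable D0 : D !=set0.
HB.instance Definition _ := Choice.on (pointed_subset D0).

Lemma pointed_subset_ex : exists x, x \in D.
Proof. by case: D0 => x Dx; exists x; rewrite inE. Qed.

HB.instance Definition _ := isPointed.Build (pointed_subset D0)
  (exist _ (xchoose pointed_subset_ex) (xchooseP pointed_subset_ex)).

Definition domain :=
  g_sigma_algebra_preimageType (sval : pointed_subset D0 -> measurableTypeR R).

End domain.

Section product_space.
Context (I : Type) (d : I -> measure_display)
  (T : forall i, measurableType (d i)).

Definition cylinders : set (set (forall i, T i)) :=
  \bigcup_i [set (fun u => u i) @^-1` B | B in (measurable : set (set (T i)))].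

Definition product_space := g_sigma_algebraType cylinders.

Definition component (i : I) (u : product_space) : T i := u i.

Lemma measurable_component i : measurable_fun setT (@component i).
Proof.
move=> _ B mB; rewrite setTI; apply: sub_sigma_algebra.
by exists i => //; exists B.
Qed.

HB.instance Definition _ i :=
  isMeasurableFun.Build _ _ _ _ (@component i) (@measurable_component i).

End product_space.

Definition inputs (R : realType) (p : nat) (D : 'I_p -> set R)
    (D0 : forall i, D i !=set0) :=
  product_space (fun i => domain (D0 i)).

Section subvector.
Context (R : realType) (p : nat) (D : 'I_p -> set R)
  (D0 : forall i, D i !=set0) (A : {set 'I_p}).

Definition subinputs :=
  product_space (fun i : {i : 'I_p | i \in A} => domain (D0 (sval i))).

Definition subvector (u : inputs D0) : subinputs := fun i => u (sval i).

Lemma measurable_subvector : measurable_fun setT subvector.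
Proof.
apply: measurability => //= _ [_ [i _ [B mB] <-] <-].
by rewrite setTI; apply: sub_sigma_algebra; exists (val i) => //; exists B.
Qed.

HB.instance Definition _ :=
  isMeasurableFun.Build _ _ _ _ subvector measurable_subvector.

Definition product_kernel (K : forall i, domain (D0 i) -> domain (D0 i) -> R)
    (u u' : subinputs) : R :=
  \prod_(i : {i : 'I_p | i \in A}) K (sval i) (u i) (u' i).

End subvector.
Arguments subvector {R p D D0} A u.
Arguments product_kernel {R p D D0} A K u u'.

Section probability_notions.
Context {R : realType} {d : measure_display} {Omega : measurableType d}
  (P : probability Omega R).
Local Open Scope ereal_scope.

Definition mutually_independent (I : finType) (dI : I -> measure_display)
    (T : forall i, measurableType (dI i)) (X : forall i, Omega -> T i) : Prop :=
  forall (J : {set I}) (B : forall i, set (T i)),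
    (forall i, measurable (B i)) ->
    P (\bigcap_(i in [set` J]) (X i @^-1` B i)) =
    \big[*%E/1]_(i in J) P (X i @^-1` B i).

Definition independent d1 d2 (T1 : measurableType d1) (T2 : measurableType d2)
    (X : Omega -> T1) (Y : Omega -> T2) : Prop :=
  forall B1 B2, measurable B1 -> measurable B2 ->
    P (X @^-1` B1 `&` Y @^-1` B2) = P (X @^-1` B1) * P (Y @^-1` B2).

Definition same_law d1 (T : measurableType d1) (X Y : Omega -> T) : Prop :=
  forall B, measurable B -> P (X @^-1` B) = P (Y @^-1` B).

Definition uniform_on n (S : set 'rV[R]_n.+1) (X : Omega -> borel_rV R n) :=
  forall B : set (borel_rV R n), measurable B ->
    P (X @^-1` B) = (fine (leb (B `&` S)) / fine (leb S))%:E.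

Definition is_cond_exp d1 (T : measurableType d1) (Y : Omega -> R)
    (V : Omega -> T) (c : Omega -> R) : Prop :=
  [/\ forall B : set R, measurable B ->
        g_sigma_algebra_preimage V (c @^-1` B),
      P.-integrable setT (EFin \o c) &
      forall B : set T, measurable B ->
        \int[P]_(w in V @^-1` B) (c w)%:E = \int[P]_(w in V @^-1` B) (Y w)%:E].

(* A version of E[Y | V], which exists as soon as Y is integrable (the        *)
(* default value 0 is used otherwise).                                        *)
Definition cond_exp d1 (T : measurableType d1) (Y : Omega -> R)
    (V : Omega -> T) : Omega -> R :=
  xget (fun=> 0%R) [set c | is_cond_exp Y V c].

Definition cond_var d1 (T : measurableType d1) (Y : Omega -> R)
    (V : Omega -> T) : Omega -> R :=
  cond_exp (fun w => (Y w - cond_exp Y V w) ^+ 2)%R V.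

End probability_notions.

Section pair_of_random_elements.
Context d d1 d2 (T : measurableType d) (T1 : measurableType d1)
  (T2 : measurableType d2) (X : {mfun T >-> T1}) (Y : {mfun T >-> T2}).

Definition pairRV (w : T) : T1 * T2 := (X w, Y w).

Lemma measurable_pairRV : measurable_fun setT pairRV.
Proof. exact: measurable_fun_pair. Qed.

HB.instance Definition _ :=
  isMeasurableFun.Build _ _ _ _ pairRV measurable_pairRV.

End pair_of_random_elements.

Section kernels.
Context {R : realType}.

Definition is_kernel (Z : Type) (k : Z -> Z -> R) : Prop :=
  (forall z z', k z z' = k z' z) /\
  (forall (n : nat) (a : 'I_n -> R) (z : 'I_n -> Z),
     0 <= \sum_(i < n) \sum_(j < n) a i * a j * k (z i) (z j)).

Definition anova_kernel d (T : measurableType d) (mu : {measure set T -> \bar R})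
    (K : T -> T -> R) : Prop :=
  [/\ measurable_fun setT (fun z : T * T => K z.1 z.2),
      is_kernel (fun u z => K u z - 1) &
      forall u, mu.-integrable setT (fun z => (K u z - 1)%:E) /\
                (\int[mu]_z (K u z - 1)%:E = 0)%E].

Definition tensor (Z1 Z2 : Type) (k1 : Z1 -> Z1 -> R) (k2 : Z2 -> Z2 -> R)
  (z z' : Z1 * Z2) : R := k1 z.1 z'.1 * k2 z.2 z'.2.

(* A reproducing kernel Hilbert space of k: a Hilbert space of functions,     *)
(* containing the k z, whose evaluations are the inner products against the   *)
(* k z. The inner product is meaningful on rkhs_fun only.  By the             *)
(* Moore-Aronszajn theorem it exists and is unique for each kernel k.         *)
Record rkhs (Z : Type) (k : Z -> Z -> R) := Rkhs {
  rkhs_fun : set (Z -> R) ;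
  rkhs_dot : (Z -> R) -> (Z -> R) -> R ;
  rkhs_fun0 : rkhs_fun (fun=> 0) ;
  rkhs_funL : forall a f g, rkhs_fun f -> rkhs_fun g ->
    rkhs_fun (fun z => a * f z + g z) ;
  rkhs_dotC : forall f g, rkhs_fun f -> rkhs_fun g ->
    rkhs_dot f g = rkhs_dot g f ;
  rkhs_dotL : forall a f g h, rkhs_fun f -> rkhs_fun g -> rkhs_fun h ->
    rkhs_dot (fun z => a * f z + g z) h = a * rkhs_dot f h + rkhs_dot g h ;
  rkhs_dot_ge0 : forall f, rkhs_fun f -> 0 <= rkhs_dot f f ;
  rkhs_dot_eq0 : forall f, rkhs_fun f -> rkhs_dot f f = 0 -> f = (fun=> 0) ;
  rkhs_complete : forall u : nat -> Z -> R, (forall n, rkhs_fun (u n)) ->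
    (forall e : R, 0 < e -> exists N, forall m n, (N <= m)%N -> (N <= n)%N ->
       rkhs_dot (u m \- u n) (u m \- u n) < e) ->
    exists2 f, rkhs_fun f & rkhs_dot (u n \- f) (u n \- f) @[n --> \oo] --> 0 ;
  rkhs_kernel : forall z, rkhs_fun (k z) ;
  rkhs_reproducing : forall z f, rkhs_fun f -> rkhs_dot f (k z) = f z }.

(* Evaluated at z, the kernel mean embedding \int k(z', .) dmu(z').           *)
Definition mean_embedding d (Z : measurableType d) (k : Z -> Z -> R)
    (mu : {measure set Z -> \bar R}) (z : Z) : R :=
  \int[mu]_z' k z' z.

Definition HSIC d d1 d2 (Omega : measurableType d) (P : probability Omega R)
    (T1 : measurableType d1) (T2 : measurableType d2)
    (k1 : T1 -> T1 -> R) (k2 : T2 -> T2 -> R) (H : rkhs (tensor k1 k2))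
    (X : {RV P >-> T1}) (Y : {RV P >-> T2}) : R :=
  let diff : T1 * T2 -> R :=
    mean_embedding (tensor k1 k2) (distribution P (pairRV X Y)) \-
    mean_embedding (tensor k1 k2) (distribution P X \x distribution P Y)%E in
  rkhs_dot H diff diff.

End kernels.
Arguments HSIC {R d d1 d2 Omega} P {T1 T2 k1 k2} H X Y.

(* Main.v *)
(** Let [L = lambda(X) / (2 sigma^2)].  If Y is uniform on X, the measure of a
    symmetric difference is lambda(X) times the probability that Y falls in it,
    so that [k_set(eta u, eta v) = exp(- L p(u, v))] where p(u, v) is the
    probability that Y falls in the symmetric difference of eta u and eta v; the
    estimator replaces p by an empirical mean.

    HSIC.  Riesz' theorem in the closed subspace of measurable functions of the
    RKHS represents f |-> E f(U_A, Gamma) - E f(U_A, Gamma') by the difference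
    of the two mean embeddings, whose squared norm is therefore a double
    expectation.  Since K_A has mean 1 in each variable (product of independent
    ANOVA factors), this difference is (a, g) |-> E[(K_A(U_A, a) - 1)
    k_set(Gamma, g)] and HSIC = E[(K_A(U_A, U_A') - 1) k_set(Gamma, Gamma')].
    The same function is the conditional expectation occurring in sigma_2^2.

    Error.  (a + b)^2 <= 2 a^2 + 2 b^2 separates the error of the U-statistic
    built with the exact k_set, whose variance is a count of covariances, from
    the Monte Carlo error.  The latter is an average over the pairs i < j, and
    |exp(- x) - exp(- y)| <= |x - y| bounds each term by L |K_A - 1| times the
    centred empirical mean of m indicators, with second moment
    E[(K_A - 1)^2 p (1 - p)] / m.  Finally p (1 - p), the conditional variance
    given (U, U'), is on average at most the conditional variance given the
    coarser (U_A, U_A', Gamma, Gamma') of sigma_3^2. *)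

Require Import Defs.
From HB Require Import structures.
From mathcomp Require Import all_boot all_order all_algebra.
From mathcomp Require Import all_classical all_reals all_analysis.
From mathcomp Require Import measurable_realfun ring lra.

Set Implicit Arguments.
Unset Strict Implicit.
Unset Printing Implicit Defensive.

Import Order.TTheory GRing.Theory Num.Theory.
Import numFieldTopology.Exports numFieldNormedType.Exports.

Local Open Scope classical_set_scope.
Local Open Scope ring_scope.

(** * Representation of functionals in a reproducing kernel Hilbert space *)

(** [kset] is measurable in each argument, but joint measurability on [Lstar X * Lstar X], for the
    product sigma-algebra, is not established. Two devices work around this. Pulled back along
    [eta], the kernel becomes exp(- L p(u, v)), where p is measurable by Tonelli because [G] is;
    this is why the HSIC section keeps the maps [x] and [y] and integrates over inputs rather than
    over the laws of U_A and Gamma. The conditional expectation in sigma_2^2, however, must be a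
    measurable function of (Gamma, U_A) itself, out of reach of Fubini without joint measurability.
    There the RKHS argument does double work: a pointwise limit of measurable functions is
    measurable, so the representer is measurable by construction, and it is then identified with the
    function wanted. A second concern is that [cond_exp] and [Rintegral] are total: a conditional
    expectation without a version and an infinite integral both collapse to 0. Existence and
    integrability therefore have to accompany the equalities and inequalities. *)

Section rkhs_representation.
Context {R : realType} {Z : Type} {k : Z -> Z -> R} (H : rkhs k).
Implicit Types f g h : Z -> R.
Local Notation F := (rkhs_fun H).
Local Notation dot := (rkhs_dot H).

(** Common source of three estimates: Cauchy-Schwarz in the RKHS, the almost-minimiser bound, and
    Cauchy-Schwarz for a kernel. *)
Lemma quadratic_ge0_discr (a b c : R) : 0 <= a ->
  (forall t, 0 <= t ^+ 2 * a + 2 * t * b + c) -> b ^+ 2 <= a * c.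
Proof.
rewrite le_eqVlt => /predU1P[<-|a0] q.
  rewrite mul0r; have [->|b0] := eqVneq b 0; first by rewrite expr0n.
  (* An affine polynomial with nonzero slope is negative somewhere: at this point its value is
     -1. *)
  have := q (- (c + 1) / (2 * b)).
  rewrite (_ : _ + c = -1) ?ler0N1//.
  by field.
have := q (- b / a); rewrite (_ : _ + c = (a * c - b ^+ 2) / a).
  by rewrite pmulr_lge0 ?invr_gt0// subr_ge0.
by field; rewrite gt_eqF.
Qed.

Lemma rkhs_funB f g : F f -> F g -> F (f \- g).
Proof.
move=> Ff Fg; rewrite (_ : f \- g = fun z => -1 * g z + f z).
  exact: rkhs_funL.
by apply/funext => z /=; rewrite mulN1r addrC.
Qed.

Lemma rkhs_dotR a f g h : F f -> F g -> F h ->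
  dot h (fun z => a * f z + g z) = a * dot h f + dot h g.
Proof.
move=> Ff Fg Fh; rewrite rkhs_dotC//; last exact: rkhs_funL.
by rewrite rkhs_dotL// [dot f h]rkhs_dotC// [dot g h]rkhs_dotC.
Qed.

Lemma rkhs_dotBl f g h : F f -> F g -> F h ->
  dot (f \- g) h = dot f h - dot g h.
Proof.
move=> Ff Fg Fh; rewrite (_ : f \- g = fun z => -1 * g z + f z).
  by rewrite rkhs_dotL// mulN1r addrC.
by apply/funext => z /=; rewrite mulN1r addrC.
Qed.

Lemma rkhs_dot_line t f h : F f -> F h ->
  dot (fun z => t * h z + f z) (fun z => t * h z + f z) =
  t ^+ 2 * dot h h + 2 * t * dot f h + dot f f.
Proof.
move=> Ff Fh.
rewrite rkhs_dotR//; last exact: rkhs_funL.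
by rewrite !rkhs_dotL// [dot h f]rkhs_dotC//; ring.
Qed.

Lemma rkhs_cauchy_schwarz f h : F f -> F h ->
  dot f h ^+ 2 <= dot h h * dot f f.
Proof.
move=> Ff Fh; apply: quadratic_ge0_discr => [|t]; first exact: rkhs_dot_ge0.
by rewrite -rkhs_dot_line//; apply: rkhs_dot_ge0; exact: rkhs_funL.
Qed.

Lemma rkhs_kernel_sym z z' : k z z' = k z' z.
Proof.
rewrite -(rkhs_reproducing z' (rkhs_kernel H z)).
by rewrite rkhs_dotC ?rkhs_reproducing//; exact: rkhs_kernel.
Qed.

(** Cauchy-Schwarz against [k z]. Norm convergence therefore implies pointwise convergence, the form
    in which [V] is assumed closed. *)
Lemma rkhs_eval_sqr f z : F f -> f z ^+ 2 <= k z z * dot f f.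
Proof.
move=> Ff; rewrite -{1}(rkhs_reproducing z Ff).
rewrite -[k z z](rkhs_reproducing z (rkhs_kernel H z)).
by apply: rkhs_cauchy_schwarz => //; exact: rkhs_kernel.
Qed.

Variables (V : set (Z -> R)) (l : (Z -> R) -> R) (C : R).
Hypothesis VF : V `<=` F.
Hypothesis V0 : V (fun=> 0).
Hypothesis Vk : forall z, V (k z).
Hypothesis VL : forall a f g, V f -> V g -> V (fun z => a * f z + g z).
Hypothesis Vlim : forall (u : nat -> Z -> R) f, (forall n, V (u n)) -> F f ->
  (forall z, u n z @[n --> \oo] --> f z) -> V f.
Hypothesis lL : forall a f g, V f -> V g ->
  l (fun z => a * f z + g z) = a * l f + l g.
Hypothesis l_bnd : forall f, V f -> 2 * l f <= dot f f + C.

(* Riesz' argument: the representer of [l] minimises [J].  It is run inside   *)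
(* the closed subspace [V] (below, the measurable functions of [H]) so that   *)
(* the representer is known to be in [V].                                     *)
Let J f := dot f f - 2 * l f.
Let S := [set J f | f in V].

Let J_inf : has_inf S.
Proof.
split; first by exists (J (fun=> 0)), (fun=> 0).
by exists (- C) => _ [f Vf <-]; rewrite /J; have := l_bnd Vf; lra.
Qed.

Let VB f g : V f -> V g -> V (f \- g).
Proof.
move=> Vf Vg; rewrite (_ : f \- g = fun z => -1 * g z + f z); first exact: VL.
by apply/funext => z /=; rewrite mulN1r addrC.
Qed.

(** Moving from [f] along [t * h] cannot lower [J] by more than [e], so t^2 [dot h h] + 2 t
    ([dot f h - l h]) + [e] is nonnegative for all t. A true minimiser ([e = 0]) would represent [l]
    exactly. *)
Let J_almost_min f h (e : R) : V f -> V h -> J f <= inf S + e ->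
  (dot f h - l h) ^+ 2 <= dot h h * e.
Proof.
move=> Vf Vh Jf; apply: quadratic_ge0_discr => [|t].
  exact/rkhs_dot_ge0/VF.
have : inf S <= J (fun z => t * h z + f z).
  apply: ge_inf; first exact: J_inf.2.
  by exists (fun z => t * h z + f z) => //; exact: VL.
rewrite /J rkhs_dot_line ?lL//; [|exact: VF..].
by move: Jf; rewrite /J; lra.
Qed.

Let small_le0 (x : R) (a : nat -> R) :
  (forall n, x <= a n) -> a n @[n --> \oo] --> 0 -> x <= 0.
Proof.
move=> xa a0; rewrite -(cvg_lim _ a0)//; apply: limr_ge; first exact: cvgP a0.
exact: nearW.
Qed.

(** A representer [f0] of [l] has the values f0 z = dot f0 (k z) = l (k z), and testing it against
    itself gives its squared norm. This both places the difference of mean embeddings in the RKHS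
    and computes its norm. *)
Lemma rkhs_representer :
  let f0 z := l (k z) in V f0 /\ dot f0 f0 = l f0.
Proof.
have uP n : {f | V f /\ J f <= inf S + n.+1%:R^-1}.
  apply: cid; have n0 : 0 < n.+1%:R^-1 :> R by [].
  have [_ [f Vf <-] Jf] := inf_adherent n0 J_inf.
  by exists f; split => //; exact: ltW.
pose u n := sval (uP n).
have Vu n : V (u n) by case: (svalP (uP n)).
have Ju n : J (u n) <= inf S + n.+1%:R^-1 by case: (svalP (uP n)).
have Fu n : F (u n) by exact: VF.
(* The direction tested for both functions is their own difference. Its squared norm D equals (x -
   w) - (y - w), so D^2 <= 2 D (e1 + e2), and a factor D cancels. *)
have dist m n : dot (u m \- u n) (u m \- u n) <= 2 * (m.+1%:R^-1 + n.+1%:R^-1).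
  have Vh := VB (Vu m) (Vu n); have Fh := VF Vh.
  have h1 := J_almost_min (Vu m) Vh (Ju m).
  have h2 := J_almost_min (Vu n) Vh (Ju n).
  have hD := rkhs_dotBl (Fu m) (Fu n) Fh.
  have hD0 := rkhs_dot_ge0 Fh.
  move: h1 h2 hD hD0.
  set D := dot (u m \- u n) _; set x := dot (u m) _; set y := dot (u n) _.
  set w := l _; set e1 := _^-1; set e2 := _^-1 => h1 h2 hD hD0.
  have [->|D0] := eqVneq D 0.
    have : 0 <= e1 by rewrite /e1.
    have : 0 <= e2 by rewrite /e2.
    by lra.
  have Dgt0 : 0 < D by rewrite lt_neqAle eq_sym D0.
  have : D * D <= D * (2 * (e1 + e2)).
    have := sqr_ge0 ((x - w) + (y - w)).
    by rewrite {1}hD {1}hD; move: h1 h2; rewrite !expr2; lra.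
  by rewrite ler_pM2l.
have inv0 : (n.+1%:R^-1 : R) @[n --> \oo] --> 0 by exact: cvg_harmonic.
have [f0 Ff0 uf0] : exists2 f, F f &
    dot (u n \- f) (u n \- f) @[n --> \oo] --> 0.
  apply: rkhs_complete => // e e0.
  have e4 : 0 < e / 4 by rewrite divr_gt0.
  have [N _ hN] := cvgr_lt _ inv0 _ e4.
  exists N => m n Nm Nn; apply: le_lt_trans (dist m n) _.
  move: (hN _ Nm) (hN _ Nn) => /=.
  by set a := m.+1%:R^-1; set b := n.+1%:R^-1; lra.
have Vf0 : V f0.
  apply: (Vlim Vu Ff0) => z; apply/subr_cvg0/norm_cvg0P.
  have: Num.sqrt (k z z * dot (u n \- f0) (u n \- f0)) @[n --> \oo] --> 0.
    rewrite -[X in _ --> X]sqrtr0.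
    apply: continuous_cvg; first exact: sqrt_continuous.
    by rewrite -(mulr0 (k z z)); exact: cvgMr.
  move=> h; apply: (squeeze_cvgr _ (cvg_cst 0) h).
  apply: nearW => n; rewrite normr_ge0/= -sqrtr_sqr ler_wsqrtr//.
  by apply: (rkhs_eval_sqr z (f := u n \- f0)); exact: rkhs_funB.
(* Both sides are compared with [dot (u n) h]: almost minimality controls one error, convergence of
   [u] to [f0] the other. *)
have rep h : V h -> dot f0 h = l h.
  move=> Vh; have Fh := VF Vh; apply/eqP.
  rewrite -subr_eq0 -sqrf_eq0 eq_le sqr_ge0 andbT.
  apply: (@small_le0 _ (fun n => 2 * (dot h h * n.+1%:R^-1) +
    2 * (dot h h * dot (u n \- f0) (u n \- f0)))) => [n|].
    have := J_almost_min (Vu n) Vh (Ju n).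
    have := rkhs_cauchy_schwarz (rkhs_funB (Fu n) Ff0) Fh.
    rewrite rkhs_dotBl//.
    set a := _^-1; set b := dot (u n \- f0) _; set D := dot h h.
    set x := dot (u n) h; set y := dot f0 h; set w := l h.
    have : 0 <= (x - w + (x - y)) ^+ 2 by exact: sqr_ge0.
    by nra.
  rewrite -[X in _ --> X]addr0 -{1}(mulr0 2) -{2}(mulr0 2) -(mulr0 (dot h h)).
  by apply: cvgD; apply: cvgMr; exact: cvgMr.
suff -> : (fun z => l (k z)) = f0 by split => //; exact: rep.
by apply/funext => z; rewrite -rep// rkhs_reproducing.
Qed.

End rkhs_representation.

(** * Integration and independence *)

Section integration.
Context {R : realType} d {T : measurableType d} (P : probability T R).
Implicit Types f g : T -> R.
Local Notation L1 f := (P.-integrable setT (fun w => (f w)%:E)).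

Lemma L1_dominated f g : measurable_fun setT f -> L1 g ->
  (forall w, `|f w| <= g w) -> L1 f.
Proof.
move=> mf ig fg; apply: le_integrable ig => //; first exact/measurable_EFinP.
by move=> w _ /=; rewrite lee_fin (le_trans (fg w))// ler_norm.
Qed.

Lemma L1_measurable f : L1 f -> measurable_fun setT f.
Proof. by move=> /(measurable_int P)/measurable_EFinP. Qed.

Lemma L1_cst c : L1 (fun=> c).
Proof. exact: finite_measure_integrable_cst. Qed.

Lemma L1D f g : L1 f -> L1 g -> L1 (fun w => f w + g w).
Proof. by move=> If Ig; have := integrableD measurableT If Ig. Qed.

Lemma L1B f g : L1 f -> L1 g -> L1 (fun w => f w - g w).
Proof. by move=> If Ig; have := integrableB measurableT If Ig. Qed.

Lemma L1Z c f : L1 f -> L1 (fun w => c * f w).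
Proof. by move=> If; have := integrableZl measurableT c If. Qed.

Lemma L1_sum (I : Type) (s : seq I) (Q : pred I) (F : I -> T -> R) :
  (forall i, Q i -> L1 (F i)) -> L1 (fun w => \sum_(i <- s | Q i) F i w).
Proof.
move=> IF; have := @integrable_sum _ _ _ P _ measurableT _ s Q _ IF.
by apply: eq_integrable => // w _; rewrite sumEFin.
Qed.

Lemma L1M_sqr f g : measurable_fun setT f -> measurable_fun setT g ->
  L1 (fun w => f w ^+ 2) -> L1 (fun w => g w ^+ 2) -> L1 (fun w => f w * g w).
Proof.
move=> mf mg If Ig; apply: (L1_dominated _ (L1D If Ig)).
  exact: measurable_funM.
move=> w; rewrite normrM -[f w ^+ 2]real_normK ?num_real//.
rewrite -[g w ^+ 2]real_normK ?num_real//.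
have := sqr_ge0 (`|f w| - `|g w|); have := normr_ge0 (f w).
by have := normr_ge0 (g w); nra.
Qed.

Lemma L1_of_sqr f : measurable_fun setT f -> L1 (fun w => f w ^+ 2) -> L1 f.
Proof.
move=> mf If; have : L1 (fun w => f w * 1).
  apply: L1M_sqr => //; exact: L1_cst.
by under eq_fun do rewrite mulr1.
Qed.

Lemma L1D_sqr f g : measurable_fun setT f -> measurable_fun setT g ->
  L1 (fun w => f w ^+ 2) -> L1 (fun w => g w ^+ 2) ->
  L1 (fun w => (f w + g w) ^+ 2).
Proof.
move=> mf mg If Ig; apply: (L1_dominated _ (L1Z 2 (L1D If Ig))).
  by apply: measurable_funX; exact: measurable_funD.
move=> w; rewrite ger0_norm ?sqr_ge0//.
by have := sqr_ge0 (f w - g w); rewrite !sqrrD sqrrN; lra.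
Qed.

Lemma L1_sum_sqr (I : Type) (s : seq I) (Q : pred I) (F : I -> T -> R) :
  (forall i, Q i -> measurable_fun setT (F i)) ->
  (forall i, Q i -> L1 (fun w => F i w ^+ 2)) ->
  L1 (fun w => (\sum_(i <- s | Q i) F i w) ^+ 2).
Proof.
move=> mF IF.
have : measurable_fun setT (fun w => \sum_(i <- s | Q i) F i w) /\
  L1 (fun w => (\sum_(i <- s | Q i) F i w) ^+ 2); last by case.
elim: s => [|i s [mih Iih]].
  under eq_fun do rewrite big_nil.
  by split=> //; under eq_fun do rewrite big_nil; exact: L1_cst.
under eq_fun do rewrite big_cons.
have [Qi|Qi] := boolP (Q i); last first.
  split => //.
  by under eq_fun do rewrite big_cons (negbTE Qi).
split; first by apply: measurable_funD => //; exact: mF.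
under eq_fun do rewrite big_cons Qi.
by apply: L1D_sqr => //; [exact: mF|exact: IF].
Qed.

Lemma measurable_sum_cond (I : Type) (s : seq I) (Q : pred I) (F : I -> T -> R) :
  (forall i, Q i -> measurable_fun setT (F i)) ->
  measurable_fun setT (fun w => \sum_(i <- s | Q i) F i w).
Proof.
move=> mF.
rewrite (_ : (fun w => _) = fun w => \sum_(i <- s) if Q i then F i w else 0).
  by apply: measurable_sum => i; move: (mF i); case: (Q i) => // mFi; exact: mFi.
by apply/funext => w; rewrite big_mkcond.
Qed.

Lemma Rintegral_sum (I : Type) (s : seq I) (Q : pred I) (F : I -> T -> R) :
  (forall i, Q i -> L1 (F i)) ->
  \int[P]_w (\sum_(i <- s | Q i) F i w) = \sum_(i <- s | Q i) \int[P]_w F i w.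
Proof.
move=> IF; elim: s => [|i s ih].
  rewrite big_nil; under eq_Rintegral do rewrite big_nil.
  by rewrite Rintegral_cst// mul0r.
rewrite big_cons -ih; under eq_Rintegral do rewrite big_cons.
have [Qi|//] := ifP.
by rewrite RintegralD//; [exact: IF|exact: L1_sum].
Qed.

Lemma EFin_Rintegral f : L1 f -> (\int[P]_w f w)%:E = (\int[P]_w (f w)%:E)%E.
Proof. by move=> If; rewrite fineK//; exact: integrable_fin_num. Qed.

Lemma Rintegral_prob_cst c : \int[P]_w (c : R) = c.
Proof. by rewrite Rintegral_cst//= probability_setT mulr1. Qed.

Lemma Rintegral_sqr_le f : L1 f -> L1 (fun w => f w ^+ 2) ->
  (\int[P]_w f w) ^+ 2 <= \int[P]_w (f w ^+ 2).
Proof.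
move=> If If2; set t := \int[P]_w f w.
have : 0 <= \int[P]_w ((f w - t) ^+ 2) by apply: Rintegral_ge0 => w _; exact: sqr_ge0.
have -> : \int[P]_w ((f w - t) ^+ 2) =
    \int[P]_w (f w ^+ 2 + (- (2 * t) * f w + t ^+ 2)).
  by apply: eq_Rintegral => w _; ring.
rewrite RintegralD//; last by apply: L1D; [exact: L1Z|exact: L1_cst].
rewrite RintegralD//; [|exact: L1Z|exact: L1_cst].
rewrite RintegralZl// Rintegral_prob_cst -/t -subr_ge0.
by congr (0 <= _); ring.
Qed.

Lemma L1_01 f : measurable_fun setT f -> (forall w, 0 <= f w <= 1) -> L1 f.
Proof.
move=> mf f01; apply: (L1_dominated mf (L1_cst 1)) => w.
by have /andP[? ?] := f01 w; rewrite ger0_norm.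
Qed.

Lemma Rintegral01 f : measurable_fun setT f -> (forall w, 0 <= f w <= 1) ->
  0 <= \int[P]_w f w <= 1.
Proof.
move=> mf f01; rewrite Rintegral_ge0//=; last by move=> w _; case/andP: (f01 w).
rewrite -[leRHS]Rintegral_prob_cst; apply: le_Rintegral => //; first exact: L1_01.
  exact: L1_cst.
by move=> w _; case/andP: (f01 w).
Qed.

End integration.

(** * Integrals of functions of two independent variables *)

Section independence.
Context {R : realType} d {Omega : measurableType d} (P : probability Omega R).
Context d1 d2 {T1 : measurableType d1} {T2 : measurableType d2}.
Local Notation L1 f := (P.-integrable setT (fun w => (f w)%:E)).

(** The positive and negative parts are transported separately, so the identity covers every
    measurable [f], whatever its integral. *)
Lemma integral_distribution_comp d' (T : measurableType d') (X : {mfun Omega >-> T})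
    (f : T -> \bar R) : measurable_fun setT f ->
  (\int[distribution P X]_x f x = \int[P]_w f (X w))%E.
Proof.
move=> mf; rewrite integralE [RHS]integralE; congr (_ - _)%E.
  rewrite ge0_integral_distribution//; last exact: measurable_funepos.
  by rewrite -funepos_comp.
rewrite ge0_integral_distribution//; last exact: measurable_funeneg.
by rewrite -funeneg_comp.
Qed.

Lemma same_law_integral d' (T : measurableType d') (X Y : {mfun Omega >-> T})
    (f : T -> \bar R) : same_law P X Y -> measurable_fun setT f ->
  (\int[P]_w f (X w) = \int[P]_w f (Y w))%E.
Proof.
move=> XY mf; rewrite -!integral_distribution_comp//.
by apply: eq_measure_integral => A mA _; exact: XY.
Qed.

Lemma same_law_Rintegral d' (T : measurableType d') (X Y : {mfun Omega >-> T})
    (f : T -> R) : same_law P X Y -> measurable_fun setT f ->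
  \int[P]_w f (X w) = \int[P]_w f (Y w).
Proof.
move=> XY mf; congr fine; apply: (same_law_integral (f := EFin \o f)) => //.
exact/measurable_EFinP.
Qed.

Lemma same_law_L1 d' (T : measurableType d') (X Y : {mfun Omega >-> T})
    (f : T -> R) : same_law P X Y -> measurable_fun setT f ->
  L1 (f \o X) -> L1 (f \o Y).
Proof.
move=> XY mf /integrableP[_ If]; apply/integrableP; split.
  by apply/measurable_EFinP; exact: measurableT_comp.
rewrite -(same_law_integral (f := fun x => `|(f x)%:E|%E) XY)//.
by apply: measurableT_comp => //; exact/measurable_EFinP.
Qed.

(* Uniqueness of finite measures, applied to [P (_ `&` E)] and [P _ * P E].   *)
Lemma independent_pair_event (X : {mfun Omega >-> T1}) (Y : {mfun Omega >-> T2})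
    (E : set Omega) : measurable E ->
  (forall A B, measurable A -> measurable B ->
    P ((X @^-1` A `&` Y @^-1` B) `&` E) = (P (X @^-1` A `&` Y @^-1` B) * P E)%E) ->
  forall C, measurable C ->
    P (pairRV X Y @^-1` C `&` E) = (P (pairRV X Y @^-1` C) * P E)%E.
Proof.
move=> mE XYE C mC.
have mXY : measurable_fun setT (pairRV X Y) by exact: measurable_pairRV.
pose pm : {measure set (T1 * T2) -> \bar R} :=
  pushforward (mrestr P mE) (pairRV X Y).
pose m1 := pm mXY.
have PE0 : 0 <= fine (P E) by rewrite fine_ge0.
pose m2 : {measure set (T1 * T2) -> \bar R} :=
  mscale (NngNum PE0) (distribution P (pairRV X Y)).
have m2E A : m2 A = (P (pairRV X Y @^-1` A) * P E)%E.
  by rewrite /m2/= /mscale/= fineK ?fin_num_measure// muleC.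
rewrite -m2E -[LHS]/(m1 C); apply: (measure_unique
    [set A `*` B | A in measurable & B in measurable] (fun=> setT)) => //.
- by rewrite measurable_prod_measurableType.
- move=> _ _ [A mA [B mB <-]] [A' mA' [B' mB' <-]]; rewrite -setXI.
  exists (A `&` A'); first exact: measurableI.
  by exists (B `&` B') => //; exact: measurableI.
- by move=> _; exists setT => //; exists setT => //; rewrite setXTT.
- by rewrite bigcup_const//; exists 0%N.
- by move=> _ [A mA [B mB <-]]; rewrite m2E; exact: XYE.
- move=> _; rewrite /m1/= /pushforward /mrestr preimage_setT setTI.
  by rewrite -ge0_fin_numE// fin_num_measure.
Qed.

Lemma independent_distribution (X : {mfun Omega >-> T1}) (Y : {mfun Omega >-> T2}) :
  independent P X Y -> forall C, measurable C ->
  distribution P (pairRV X Y) C = (distribution P X \x distribution P Y)%E C.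
Proof.
by move=> XY C mC; apply/esym/product_measure_unique => // A B mA mB; exact: XY.
Qed.

Variables (X : {mfun Omega >-> T1}) (Y : {mfun Omega >-> T2}).
Hypothesis XY : independent P X Y.

Lemma independent_ge0_integral (F : T1 * T2 -> \bar R) :
  measurable_fun setT F -> (forall z, 0 <= F z)%E ->
  (\int[P]_w F (X w, Y w) = \int[P]_w \int[P]_w' F (X w, Y w'))%E.
Proof.
move=> mF F0.
rewrite -[LHS](@integral_distribution_comp _ _ (pairRV X Y) F mF).
rewrite (eq_measure_integral (distribution P X \x distribution P Y)%E); last first.
  by move=> A mA _; exact: independent_distribution.
rewrite fubini_tonelli1// integral_distribution_comp.
  apply: eq_integral => w _; rewrite /fubini_F integral_distribution_comp//.
  exact: measurableT_comp.
exact: measurable_fun_fubini_tonelli_F.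
Qed.

Lemma independent_integral (F : T1 * T2 -> \bar R) :
  P.-integrable setT (fun w => F (X w, Y w)) -> measurable_fun setT F ->
  (\int[P]_w F (X w, Y w) = \int[P]_w \int[P]_w' F (X w, Y w'))%E.
Proof.
move=> IF mF.
have IF' : (distribution P X \x distribution P Y)%E.-integrable setT F.
  apply/integrableP; split=> //; move/integrableP: IF => [_].
  rewrite -(@integral_distribution_comp _ _ (pairRV X Y) (abse \o F)); last first.
    exact: measurableT_comp.
  rewrite (eq_measure_integral (distribution P X \x distribution P Y)%E)//.
  by move=> A mA _; exact: independent_distribution.
rewrite -[LHS](@integral_distribution_comp _ _ (pairRV X Y) F mF).
rewrite (eq_measure_integral (distribution P X \x distribution P Y)%E); last first.
  by move=> A mA _; exact: independent_distribution.
rewrite -integral12_prod_meas1// integral_distribution_comp.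
  apply: eq_integral => w _; rewrite /fubini_F integral_distribution_comp//.
  exact: measurableT_comp.
exact: measurable_fubini_F IF'.
Qed.

(** Tonelli applies to the positive and negative parts, and [fine] of their difference is
    measurable. *)
Lemma measurable_fun_integral_snd (F : T1 * T2 -> R) :
  measurable_fun setT F -> measurable_fun setT (fun x => \int[P]_w F (x, Y w)).
Proof.
move=> mF; apply: measurableT_comp => //.
have mE : measurable_fun setT (EFin \o F) by exact/measurable_EFinP.
rewrite (_ : (fun x => _) = (fun x =>
   (\int[distribution P Y]_y (EFin \o F)^\+ (x, y) -
    \int[distribution P Y]_y (EFin \o F)^\- (x, y))%E)).
  apply: emeasurable_funB.
    apply: (measurable_fun_fubini_tonelli_F (m2 := distribution P Y)) => //.
    exact: measurable_funepos.
  apply: (measurable_fun_fubini_tonelli_F (m2 := distribution P Y)) => //.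
  exact: measurable_funeneg.
apply/funext => x; rewrite integralE; congr (_ - _)%E.
  rewrite integral_distribution_comp; first by rewrite !unlock.
  by apply: measurableT_comp => //; exact: measurable_funepos.
rewrite integral_distribution_comp; first by rewrite !unlock.
by apply: measurableT_comp => //; exact: measurable_funeneg.
Qed.

(** Integrability of every section makes the real inner integral agree everywhere with the extended
    one, so that Fubini transfers to [Rintegral]. *)
Lemma independent_Rintegral (F : T1 * T2 -> R) :
  measurable_fun setT F -> L1 (fun w => F (X w, Y w)) ->
  (forall x, L1 (fun w => F (x, Y w))) ->
  L1 (fun w => \int[P]_w' F (X w, Y w')) /\
  \int[P]_w F (X w, Y w) = \int[P]_w \int[P]_w' F (X w, Y w').
Proof.
move=> mF IF IFx.
have mE : measurable_fun setT (EFin \o F) by exact/measurable_EFinP.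
split; last first.
  rewrite /Rintegral (independent_integral (F := EFin \o F))//.
  congr fine; apply: eq_integral => w _.
  by rewrite fineK//; exact: integrable_fin_num.
apply/integrableP; split.
  apply/measurable_EFinP.
  by apply: (measurableT_comp (measurable_fun_integral_snd mF)).
move/integrableP: IF => [_]; apply: le_lt_trans.
rewrite (independent_ge0_integral (F := fun z => `|(F z)%:E|%E))//; last first.
  exact: measurableT_comp.
apply: ge0_le_integral => //.
- apply: measurableT_comp => //; apply/measurable_EFinP.
  by apply: (measurableT_comp (measurable_fun_integral_snd mF)).
- have := @measurable_fun_fubini_tonelli_F _ _ _ _ _ (distribution P Y)
    (abse \o (EFin \o F)).
  move=> /(_ (measurableT_comp (@abse_measurable R setT) mE) (fun _ => abse_ge0 _)) mG.
  rewrite (_ : (fun w => _) =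
      fubini_F (distribution P Y) (abse \o (EFin \o F)) \o X).
    exact: measurableT_comp.
  apply/funext => w; rewrite /fubini_F /= integral_distribution_comp//.
  apply/measurable_EFinP; apply: measurableT_comp => //.
  exact: (measurableT_comp mF).

- move=> w _; rewrite EFin_Rintegral//; apply: le_abse_integral => //.
  exact: (measurable_int P).
Qed.

Lemma independent_RintegralM (f : T1 -> R) (g : T2 -> R) :
  measurable_fun setT f -> measurable_fun setT g ->
  L1 (f \o X) -> L1 (g \o Y) ->
  L1 (fun w => f (X w) * g (Y w)) /\
  \int[P]_w (f (X w) * g (Y w)) = (\int[P]_w f (X w)) * (\int[P]_w g (Y w)).
Proof.
move=> mf mg If Ig.
pose F (z : T1 * T2) := f z.1 * g z.2.
have mF : measurable_fun setT F.
  by apply: measurable_funM; exact: measurableT_comp.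
have IFx x : L1 (fun w => F (x, Y w)) by exact: (L1Z (f x) Ig).
have IF : L1 (fun w => F (X w, Y w)).
  apply/integrableP; split.
    apply/measurable_EFinP/(measurableT_comp mF).
    exact: measurable_fun_pair.
  rewrite (independent_ge0_integral (F := fun z => `|(F z)%:E|%E))//; last first.
    by apply: measurableT_comp => //; exact/measurable_EFinP.
  rewrite (eq_integral (fun w => `|(f (X w))%:E| * \int[P]_w' `|(g (Y w'))%:E|)%E).
    have /integrableP[_ Ig'] := Ig; have /integrableP[_ If'] := If.
    rewrite ge0_integralZr//.
    - by rewrite lte_mul_pinfty// ?ge0_fin_numE//; exact: integral_ge0.
    - exact: measurableT_comp (measurable_int P If).
    - exact: integral_ge0.
  move=> w _; rewrite -ge0_integralZl//; last first.
    exact: measurableT_comp (measurable_int P Ig).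
  by apply: eq_integral => w' _; rewrite -abseM -EFinM.
split => //.
have [_ ->] := independent_Rintegral mF IF IFx; rewrite /F /=.
under eq_Rintegral do rewrite RintegralZl//.
by rewrite RintegralZr.
Qed.

End independence.

(** * Joint laws of pairs drawn from a sample *)

Section joint_laws.
Context {R : realType} d {Omega : measurableType d} (P : probability Omega R).

Lemma independentC d1 d2 (T1 : measurableType d1) (T2 : measurableType d2)
    (X : Omega -> T1) (Y : Omega -> T2) :
  independent P X Y -> independent P Y X.
Proof. by move=> XY A B mA mB; rewrite setIC muleC XY. Qed.

Lemma independent_comp d1 d2 d3 d4 (T1 : measurableType d1)
    (T2 : measurableType d2) (T3 : measurableType d3) (T4 : measurableType d4)
    (X : Omega -> T1) (Y : Omega -> T2) (f : T1 -> T3) (g : T2 -> T4) :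
  measurable_fun setT f -> measurable_fun setT g ->
  independent P X Y -> independent P (f \o X) (g \o Y).
Proof.
move=> mf mg XY A B mA mB; apply: (XY (f @^-1` A) (g @^-1` B)).
  by rewrite -[X in measurable X]setTI; exact: mf.
by rewrite -[X in measurable X]setTI; exact: mg.
Qed.

Lemma independent_pairl d1 d2 d3 (T1 : measurableType d1)
    (T2 : measurableType d2) (T3 : measurableType d3)
    (X : {mfun Omega >-> T1}) (Y : {mfun Omega >-> T2}) (Z : {mfun Omega >-> T3}) :
  (forall A B C, measurable A -> measurable B -> measurable C ->
    P ((X @^-1` A `&` Y @^-1` B) `&` Z @^-1` C) =
    (P (X @^-1` A `&` Y @^-1` B) * P (Z @^-1` C))%E) ->
  independent P (pairRV X Y) Z.
Proof.
move=> h C D mC mD; apply: independent_pair_event => //.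
  by rewrite -[X in measurable X]setTI; exact: measurable_funP.
by move=> A B mA mB; exact: h.
Qed.

Lemma independent_pairs d1 d2 d3 d4 (T1 : measurableType d1)
    (T2 : measurableType d2) (T3 : measurableType d3) (T4 : measurableType d4)
    (X : {mfun Omega >-> T1}) (Y : {mfun Omega >-> T2})
    (Z : {mfun Omega >-> T3}) (W : {mfun Omega >-> T4}) :
  (forall A B C D, measurable A -> measurable B -> measurable C -> measurable D ->
    P ((X @^-1` A `&` Y @^-1` B) `&` (Z @^-1` C `&` W @^-1` D)) =
    (P (X @^-1` A `&` Y @^-1` B) * P (Z @^-1` C `&` W @^-1` D))%E) ->
  independent P (pairRV X Y) (pairRV Z W).
Proof.
move=> h; apply: independent_pairl => A B E mA mB mE.
have mpre d' (T' : measurableType d') (V : {mfun Omega >-> T'}) S :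
    measurable S -> measurable (V @^-1` S).
  by move=> mS; rewrite -[X in measurable X]setTI; exact: measurable_funP.
(* [E], an event of the second pair on entry, was generalised by the first extension from
   rectangles; the roles are now exchanged, with the rectangle of the first pair as the fixed
   event. *)
rewrite setIC muleC; apply: independent_pair_event => //.
  by apply: measurableI; exact: mpre.
by move=> C D mC mD; rewrite setIC muleC h.
Qed.

Lemma same_law_pair d1 d2 (T1 : measurableType d1) (T2 : measurableType d2)
    (X X' : {mfun Omega >-> T1}) (Y Y' : {mfun Omega >-> T2}) :
  independent P X Y -> independent P X' Y' ->
  same_law P X X' -> same_law P Y Y' ->
  same_law P (pairRV X Y) (pairRV X' Y').
Proof.
move=> XY XY' XX' YY' C mC.
rewrite -[RHS]/(distribution P (pairRV X' Y') C) (independent_distribution XY')//.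
apply/esym/(product_measure_unique (m1 := distribution P X')
  (m2 := distribution P Y') (m' := distribution P (pairRV X Y))) => // A B mA mB.
by rewrite /= /distribution /= /pushforward -XX'// -YY'//; exact: XY.
Qed.

(** An explicit list of indices lets [big_cons] unfold the intersection and the product. *)
Lemma mutually_independent_seq (I : finType) (dI : I -> measure_display)
    (T : forall i, measurableType (dI i)) (X : forall i, Omega -> T i)
    (s : seq I) (B : forall i, set (T i)) :
  mutually_independent P X -> uniq s -> (forall i, measurable (B i)) ->
  P (\big[setI/setT]_(i <- s) (X i @^-1` B i)) =
  (\prod_(i <- s) P (X i @^-1` B i))%E.
Proof.
move=> indX us mB; rewrite -bigcap_seq.
have := indX [set i in s]%SET B mB.
rewrite (big_uniq _ us)/=; under [in RHS]eq_bigl do rewrite inE.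
move=> <-; congr (P _); apply/seteqP; split => w sw i /=.
  by rewrite inE; exact: sw.
by move=> si; apply: sw; rewrite /= inE.
Qed.

Section identical.
Context d1 (T : measurableType d1) (I : finType) (X : I -> {mfun Omega >-> T}).
Hypothesis indX : mutually_independent P X.

Lemma mutually_independent2 i j : i != j -> independent P (X i) (X j).
Proof.
move=> ij A B mA mB.
have := @mutually_independent_seq _ _ _ _ [:: i; j]
  (fun k => if k == i then A else B) indX.
rewrite /= inE ij => /(_ isT); rewrite !big_cons !big_nil setIT mule1.
rewrite eqxx eq_sym (negbTE ij); apply => k.
by case: ifP.
Qed.

Lemma mutually_independent3 i j k : i != j -> i != k -> j != k ->
  independent P (X i) (pairRV (X j) (X k)).
Proof.
move=> ij ik jk; apply/independentC/independent_pairl => A B C mA mB mC.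
have [ji ki kj] : [/\ j != i, k != i & k != j] by split; rewrite eq_sym.
have := @mutually_independent_seq _ _ _ _ [:: j; k; i]
  (fun l => if l == j then A else if l == k then B else C) indX.
rewrite /= !inE !negb_or jk ji ki => /(_ isT).
rewrite !big_cons !big_nil setIT mule1 !eqxx.
rewrite (negbTE kj) (negbTE ij) (negbTE ik) setIA muleA => ->.
  by rewrite -(mutually_independent2 jk).
by move=> l; do 2 case: ifP => //.
Qed.

Lemma mutually_independent4 i j k l : i != j -> k != l ->
  i != k -> i != l -> j != k -> j != l ->
  independent P (pairRV (X i) (X j)) (pairRV (X k) (X l)).
Proof.
move=> ij kl ik il jk jl; apply: independent_pairs => A B C D mA mB mC mD.
have sym (x y : I) : x != y -> y != x by rewrite eq_sym.
have := @mutually_independent_seq _ _ _ _ [:: i; j; k; l]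
  (fun l' => if l' == i then A else if l' == j then B
             else if l' == k then C else D) indX.
rewrite /= !inE !negb_or ij kl ik il jk jl => /(_ isT).
rewrite !big_cons !big_nil setIT mule1 !eqxx.
rewrite !(negbTE (sym _ _ ij)) !(negbTE (sym _ _ ik)) !(negbTE (sym _ _ il)).
rewrite !(negbTE (sym _ _ jk)) !(negbTE (sym _ _ jl)) !(negbTE (sym _ _ kl)).
rewrite setIA muleA => ->.
  by rewrite -(mutually_independent2 ij)// -(mutually_independent2 kl)// muleA.
by move=> l'; do 3 case: ifP => //.
Qed.

Lemma same_law_sample_pair (U U' : {mfun Omega >-> T}) i j :
  independent P U U' -> same_law P U' U -> (forall k, same_law P (X k) U) ->
  i != j -> same_law P (pairRV U U') (pairRV (X i) (X j)).
Proof.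
move=> UU' U'U XU ij; apply: same_law_pair => //.
- exact: mutually_independent2.
- by move=> B mB; rewrite XU.
- by move=> B mB; rewrite XU// U'U.
Qed.

End identical.
End joint_laws.

(** * U-statistics and Monte Carlo means *)

Section double_sums.
Context {R : comRingType} (n : nat).
Implicit Types (i j : 'I_n).

Lemma sum_triangle (A : 'I_n -> 'I_n -> R) : (forall i j, A i j = A j i) ->
  \sum_i \sum_(j | j != i) A i j = 2 * \sum_(i < n) \sum_(j < n | (i < j)%N) A i j.
Proof.
move=> symA; rewrite mulr_natl mulr2n.
rewrite [X in _ = _ + X](exchange_big_dep predT)//= -big_split/=.
apply: eq_bigr => i _; rewrite (bigID (fun j => (i < j)%N))/=; congr (_ + _).
  by apply: eq_bigl => j; rewrite -(inj_eq val_inj)/= neq_ltn; case: ltngtP.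
apply: eq_big => [j|j _]; last exact: symA.
by rewrite -(inj_eq val_inj)/=; case: ltngtP.
Qed.

Lemma sum_but2 i j (c : R) : i != j ->
  \sum_(k | (k != i) && (k != j)) c = (n%:R - 2) * c.
Proof.
move=> ij; have : \sum_(k < n) c = n%:R * c.
  by rewrite sumr_const card_ord mulr_natl.
rewrite (bigD1 i)//= (bigD1 j)/= 1?eq_sym//.
by rewrite mulrBl => <-; rewrite mulr_natl mulr2n; ring.
Qed.

Lemma sum_neq i (c : R) : \sum_(j | j != i) c = (n%:R - 1) * c.
Proof.
have : \sum_(k < n) c = n%:R * c by rewrite sumr_const card_ord mulr_natl.
by rewrite (bigD1 i)//= mulrBl => <-; rewrite mul1r addrAC subrr add0r.
Qed.

(* Below, [M i j k l] is the covariance of the terms of index (i, j) and      *)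
(* (k, l) of a U-statistic: [s1] if the pairs coincide, [s2] if they share    *)
(* one index, [0] if they are disjoint.                                       *)
Lemma sum_covariances (M : 'I_n -> 'I_n -> 'I_n -> 'I_n -> R) (s1 s2 : R) :
  (forall i j, i != j -> M i j i j = s1) ->
  (forall i j, i != j -> M i j j i = s1) ->
  (forall i j l, i != j -> l != i -> l != j -> M i j i l = s2) ->
  (forall i j l, i != j -> l != i -> l != j -> M i j j l = s2) ->
  (forall i j k, i != j -> k != i -> k != j -> M i j k i = s2) ->
  (forall i j k, i != j -> k != i -> k != j -> M i j k j = s2) ->
  (forall i j k l, i != j -> k != i -> k != j -> l != k -> l != i -> l != j ->
     M i j k l = 0) ->
  \sum_i \sum_(j | j != i) \sum_k \sum_(l | l != k) M i j k l =
  n%:R * (n%:R - 1) * (2 * s1 + 4 * (n%:R - 2) * s2).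
Proof.
move=> h1 h2 h3 h4 h5 h6 h7.
have row i j : i != j -> \sum_k \sum_(l | l != k) M i j k l =
    2 * s1 + 4 * (n%:R - 2) * s2.
  move=> ij; have ji : j != i by rewrite eq_sym.
  (* The rows k = i and k = j each contain one coincident pair and n - 2 pairs sharing one index;
     each of the n - 2 other rows meets {i, j} only at l = i and l = j. This gives 2 [s1] and 4 (n -
     2) [s2]. *)
  have row_i : \sum_(l | l != i) M i j i l = s1 + (n%:R - 2) * s2.
    rewrite (bigD1 j)//= h1// -(sum_but2 s2 ij); congr (_ + _).
    by apply: eq_bigr => l /andP[? ?]; exact: h3.
  have row_j : \sum_(l | l != j) M i j j l = s1 + (n%:R - 2) * s2.
    rewrite (bigD1 i)//= h2// -(sum_but2 s2 ji); congr (_ + _).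
    by apply: eq_bigr => l /andP[? ?]; exact: h4.
  have row_k k : k != i -> k != j -> \sum_(l | l != k) M i j k l = 2 * s2.
    move=> ki kj; rewrite (bigD1 i)/= 1?eq_sym// (bigD1 j)/=; last first.
      by rewrite eq_sym kj.
    rewrite h5// h6// big1 => [|l /andP[/andP[lk li] lj]]; last exact: h7.
    by rewrite addr0 mulr_natl mulr2n.
  rewrite (bigD1 i)//= row_i (bigD1 j)//= row_j.
  rewrite (eq_bigr (fun=> 2 * s2)) => [|k /andP[ki kj]]; last exact: row_k.
  by rewrite sum_but2//; ring.
rewrite (eq_bigr (fun i => (n%:R - 1) * (2 * s1 + 4 * (n%:R - 2) * s2))).
  by rewrite sumr_const card_ord -[LHS]mulr_natl mulrA.
move=> i _; rewrite -(sum_neq i); apply: eq_bigr => j ji.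
by rewrite row// eq_sym.
Qed.

End double_sums.

(** * Second moment of a centred U-statistic of order two *)

Section u_statistic.
Context {R : realType} d {Omega : measurableType d} (P : probability Omega R).
Context dT {T : measurableType dT}.
Local Notation L1 f := (P.-integrable setT (fun w => (f w)%:E)).
Variables (U U' : {mfun Omega >-> T}).
Hypotheses (UU' : independent P U U') (U'U : same_law P U' U).
Variables (n : nat) (Us : 'I_n -> {mfun Omega >-> T}).
Hypotheses (UsU : forall i, same_law P (Us i) U)
  (indUs : mutually_independent P Us).
Variable a : T * T -> R.
Hypotheses (ma : measurable_fun setT a) (syma : forall x y, a (x, y) = a (y, x)).
Hypothesis a2 : L1 (fun w => a (U w, U' w) ^+ 2).
Hypothesis a2x : forall x, L1 (fun w => a (x, U w) ^+ 2).

Let same_law_sample i j : i != j ->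
  same_law P (pairRV U U') (pairRV (Us i) (Us j)).
Proof. exact: same_law_sample_pair. Qed.

Let mas i j : measurable_fun setT (fun w => a (Us i w, Us j w)).
Proof. by apply: (measurableT_comp ma); exact: measurable_fun_pair. Qed.

Lemma L1_sample_sqr i j : i != j -> L1 (fun w => a (Us i w, Us j w) ^+ 2).
Proof.
move=> ij; apply: (same_law_L1 (same_law_sample ij) (f := fun z => a z ^+ 2)) => //.
exact: measurable_funX.
Qed.

Let L1prod i j k l : i != j -> k != l ->
  L1 (fun w => a (Us i w, Us j w) * a (Us k w, Us l w)).
Proof. by move=> ij kl; apply: L1M_sqr => //; exact: L1_sample_sqr. Qed.

Let s1 := \int[P]_w (a (U w, U' w) ^+ 2).
Let g x := \int[P]_w a (x, U w).
Let s2 := \int[P]_w (g (U w) ^+ 2).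

Let cov_same i j : i != j -> \int[P]_w (a (Us i w, Us j w) ^+ 2) = s1.
Proof.
move=> ij; apply/esym.
apply: (same_law_Rintegral (same_law_sample ij) (f := fun z => a z ^+ 2)) => //.
exact: measurable_funX.
Qed.

Let max x : measurable_fun setT (fun y => a (x, y)).
Proof. exact: measurableT_comp. Qed.

Let mg : measurable_fun setT g.
Proof. exact: measurable_fun_integral_snd. Qed.

(** Once the shared variable is frozen, the two others are independent and the inner integral
    factorises as the square of [g]. *)
Let cov_one i j l : i != j -> i != l -> j != l ->
  \int[P]_w (a (Us i w, Us j w) * a (Us i w, Us l w)) = s2.
Proof.
move=> ij il jl.
pose F (z : T * (T * T)) := a (z.1, z.2.1) * a (z.1, z.2.2).
have mF : measurable_fun setT F.
  apply: measurable_funM; apply: (measurableT_comp ma); apply: measurable_fun_pair => //.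
    exact: (measurableT_comp measurable_fst measurable_snd).
  exact: (measurableT_comp measurable_snd measurable_snd).
have Lx x k : L1 (fun w => a (x, Us k w)).
  apply: (same_law_L1 (X := U) (f := fun y => a (x, y))) => //.
    by move=> B mB; rewrite UsU.
  apply: L1_of_sqr; last exact: a2x.
  by apply: (measurableT_comp (max x)).
have inner x : L1 (fun w => a (x, Us j w) * a (x, Us l w)) /\
    \int[P]_w (a (x, Us j w) * a (x, Us l w)) = g x ^+ 2.
  have jlI := mutually_independent2 indUs jl.
  have [Ip ->] := independent_RintegralM jlI (max x) (max x) (Lx x j) (Lx x l).
  split => //; rewrite expr2; congr (_ * _).
    exact: (same_law_Rintegral (UsU j) (max x)).
  exact: (same_law_Rintegral (UsU l) (max x)).
have [_ ->] := independent_Rintegral (mutually_independent3 indUs ij il jl) mF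
  (L1prod ij il) (fun x => (inner x).1).
transitivity (\int[P]_w (g (Us i w) ^+ 2)).
  by apply: eq_Rintegral => w _; exact: (inner _).2.
apply: (same_law_Rintegral (UsU i) (f := fun x => g x ^+ 2)).
exact: measurable_funX.
Qed.

Hypothesis a0 : \int[P]_w a (U w, U' w) = 0.

Let cov_none i j k l : i != j -> k != l -> i != k -> i != l -> j != k -> j != l ->
  \int[P]_w (a (Us i w, Us j w) * a (Us k w, Us l w)) = 0.
Proof.
move=> ij kl ik il jk jl.
have L1p p q : p != q -> L1 (a \o pairRV (Us p) (Us q)).
  by move=> pq; apply: L1_of_sqr; [exact: mas|exact: L1_sample_sqr].
have [_ ->] := independent_RintegralM
  (mutually_independent4 indUs ij kl ik il jk jl) ma ma (L1p _ _ ij) (L1p _ _ kl).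
by rewrite -(same_law_Rintegral (same_law_sample ij))// a0 mul0r.
Qed.

(** The sum over ordered pairs is twice the sum over i < j, whence the 4. Its square expands into
    the second moments counted by [sum_covariances]. *)
Lemma u_statistic_second_moment (c : R) :
  \int[P]_w ((c * \sum_(i < n) \sum_(j < n | (i < j)%N) a (Us i w, Us j w)) ^+ 2) =
  c ^+ 2 * (n%:R * (n%:R - 1) / 4) * (2 * s1 + 4 * (n%:R - 2) * s2).
Proof.
pose A w i j := a (Us i w, Us j w).
have E w : (c * \sum_(i < n) \sum_(j < n | (i < j)%N) A w i j) ^+ 2 =
    c ^+ 2 / 4 * \sum_i \sum_(j | j != i) \sum_k \sum_(l | l != k) A w i j * A w k l.
  transitivity (c ^+ 2 / 4 * (\sum_i \sum_(j | j != i) A w i j) ^+ 2).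
    rewrite sum_triangle; last by move=> i j; exact: syma.
    by field.
  congr (_ * _); rewrite expr2 mulr_suml; apply: eq_bigr => i _.
  rewrite mulr_suml; apply: eq_bigr => j _.
  by rewrite mulr_sumr; apply: eq_bigr => k _; rewrite mulr_sumr.
have Lp i j k l : j != i -> l != k -> L1 (fun w => A w i j * A w k l).
  by move=> ji lk; apply: L1prod; rewrite eq_sym.
under eq_Rintegral do rewrite E.
rewrite RintegralZl//; last first.
  by do 4 (apply: L1_sum => ? ?); exact: Lp.
rewrite Rintegral_sum; last by move=> i _; do 3 (apply: L1_sum => ? ?); exact: Lp.
have -> : \sum_i \int[P]_w (\sum_(j | j != i) \sum_k \sum_(l | l != k)
      A w i j * A w k l) =
    \sum_i \sum_(j | j != i) \sum_k \sum_(l | l != k) \int[P]_w (A w i j * A w k l).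
  apply: eq_bigr => i _; rewrite Rintegral_sum; last first.
    by move=> j ?; do 2 (apply: L1_sum => ? ?); exact: Lp.
  apply: eq_bigr => j ?; rewrite Rintegral_sum; last first.
    by move=> k ?; do 1 (apply: L1_sum => ? ?); exact: Lp.
  by apply: eq_bigr => k _; rewrite Rintegral_sum// => l ?; exact: Lp.
rewrite (@sum_covariances _ _ _ s1 s2).
- by field.
- by move=> i j ij; rewrite -(cov_same ij); apply: eq_Rintegral => w _; rewrite expr2.
- move=> i j ij; rewrite -(cov_same ij); apply: eq_Rintegral => w _.
  by rewrite expr2 /A [a (Us j w, _)]syma.
- by move=> i j l ij li lj; apply: cov_one => //; rewrite eq_sym.
- move=> i j l ij li lj; rewrite -(@cov_one j i l)// 1?eq_sym//.
  by apply: eq_Rintegral => w _; rewrite /A [a (Us i w, _)]syma.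
- move=> i j l ij li lj; rewrite -(@cov_one i j l)// 1?eq_sym//.
  by apply: eq_Rintegral => w _; rewrite /A [a (Us l w, _)]syma.
- move=> i j l ij li lj; rewrite -(@cov_one j i l)// 1?eq_sym//.
  apply: eq_Rintegral => w _; rewrite /A [a (Us l w, _)]syma.
  by rewrite [a (Us i w, _)]syma.
- by move=> i j k l ij ki kj lk li lj; apply: cov_none => //; rewrite eq_sym.
Qed.

End u_statistic.

(** * Second moment of a weighted Monte Carlo mean *)

Section monte_carlo.
Context {R : realType} d {Omega : measurableType d} (P : probability Omega R).
Context d1 d2 {T1 : measurableType d1} {T2 : measurableType d2}.
Local Notation L1 f := (P.-integrable setT (fun w => (f w)%:E)).
Variables (X : {mfun Omega >-> T1}) (Y : {mfun Omega >-> T2}).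
Variables (m : nat) (Ys : 'I_m -> {mfun Omega >-> T2}).
Hypotheses (YsY : forall k, same_law P (Ys k) Y)
  (XYs : forall k, independent P X (Ys k))
  (XYs2 : forall k l, k != l -> independent P X (pairRV (Ys k) (Ys l)))
  (YsYs : forall k l, k != l -> independent P (Ys k) (Ys l)).
Variables (c : T1 -> R) (b : T1 * T2 -> R).
Hypotheses (mc : measurable_fun setT c) (mb : measurable_fun setT b).
Hypotheses (b1 : forall z, `|b z| <= 1)
  (b0 : forall x, \int[P]_w b (x, Y w) = 0).
Hypothesis c2 : L1 (fun w => c (X w) ^+ 2).

Let Lx x k : L1 (fun w => b (x, Ys k w)).
Proof.
apply: (L1_dominated _ (L1_cst P 1)) => //.
by apply: (measurableT_comp mb); exact: measurable_fun_pair.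
Qed.

Let mcb k : measurable_fun setT (fun w => c (X w) * b (X w, Ys k w)).
Proof.
apply: measurable_funM; first exact: measurableT_comp.
by apply: (measurableT_comp mb); exact: measurable_fun_pair.
Qed.

Let L2cb k : L1 (fun w => (c (X w) * b (X w, Ys k w)) ^+ 2).
Proof.
apply: (L1_dominated _ c2); first exact: measurable_funX.
move=> w; rewrite normrX normrM exprMn.
rewrite -[c (X w) ^+ 2]real_normK ?num_real// ler_piMr ?sqr_ge0//.
by rewrite expr_le1.
Qed.

(** With [X] frozen the terms are centred and pairwise independent, so only m of the m^2 products
    survive. The bound on [b] makes square integrability of the weight [c] sufficient. *)
Lemma monte_carlo_second_moment : (0 < m)%N ->
  \int[P]_w ((c (X w) * (m%:R^-1 * \sum_(k < m) b (X w, Ys k w))) ^+ 2) =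
  (\int[P]_w (c (X w) ^+ 2 * \int[P]_w' (b (X w, Y w') ^+ 2))) / m%:R.
Proof.
move=> m0.
have E w : (c (X w) * (m%:R^-1 * \sum_(k < m) b (X w, Ys k w))) ^+ 2 =
    m%:R^-2 * \sum_k \sum_l (c (X w) * b (X w, Ys k w)) * (c (X w) * b (X w, Ys l w)).
  rewrite mulrCA exprMn exprVn; congr (_ * _).
  rewrite expr2 mulr_sumr mulr_suml; apply: eq_bigr => k _.
  by rewrite mulr_sumr.
under eq_Rintegral do rewrite E.
have Lp k l : L1 (fun w => (c (X w) * b (X w, Ys k w)) * (c (X w) * b (X w, Ys l w))).
  exact: L1M_sqr.
rewrite RintegralZl//; last by do 2 (apply: L1_sum => ? _).
rewrite Rintegral_sum; last by move=> ? _; apply: L1_sum.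
under eq_bigr do rewrite Rintegral_sum//.
set S := (X in _ = X / _).
rewrite (eq_bigr (fun=> S)).
  by rewrite sumr_const card_ord -[S *+ m]mulr_natr; field; rewrite pnatr_eq0 -lt0n.
move=> k _; rewrite (bigD1 k)//= [X in _ + X]big1 ?addr0.
  pose F z := c z.1 ^+ 2 * b z ^+ 2.
  have mF : measurable_fun setT F.
    apply: measurable_funM; apply: measurable_funX => //.
    exact: measurableT_comp.
  transitivity (\int[P]_w F (X w, Ys k w)).
    by apply: eq_Rintegral => w _; rewrite /F/=; ring.
  have L2x x : L1 (fun w => b (x, Ys k w) ^+ 2).
    apply: (L1_dominated _ (L1_cst P 1)) => [|w]; last by rewrite normrX expr_le1.
    apply: measurable_funX; apply: (measurableT_comp mb).
    exact: measurable_fun_pair.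
  have LF : L1 (fun w => F (X w, Ys k w)).
    by have := L2cb k; under eq_fun do rewrite exprMn.
  have [_ ->] := independent_Rintegral (XYs k) mF LF
    (fun x => L1Z (c x ^+ 2) (L2x x)).
  apply: eq_Rintegral => w _; rewrite /F /= RintegralZl//; last exact: L2x.
  congr (_ * _).
  apply: (same_law_Rintegral (YsY k) (f := fun y => b (X w, y) ^+ 2)).
  apply: measurable_funX; apply: (measurableT_comp mb).
  exact: measurable_fun_pair.
move=> l lk; have kl : k != l by rewrite eq_sym.
pose F (z : T1 * (T2 * T2)) := c z.1 ^+ 2 * (b (z.1, z.2.1) * b (z.1, z.2.2)).
have mF : measurable_fun setT F.
  apply: measurable_funM; first by apply: measurable_funX; exact: measurableT_comp.
  apply: measurable_funM; apply: (measurableT_comp mb);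
    apply: measurable_fun_pair => //.
    exact: (measurableT_comp measurable_fst measurable_snd).
  exact: (measurableT_comp measurable_snd measurable_snd).
have FE : (fun w => c (X w) * b (X w, Ys k w) * (c (X w) * b (X w, Ys l w))) =
    (fun w => F (X w, (Ys k w, Ys l w))).
  by apply/funext => w; rewrite /F /=; ring.
have bx x : measurable_fun setT (fun y => b (x, y)).
  exact: measurableT_comp.
have inner x := independent_RintegralM (YsYs kl) (bx x) (bx x) (Lx x k) (Lx x l).
have LF : L1 (fun w => F (X w, (Ys k w, Ys l w))).
  by have := Lp k l; rewrite -[X in P.-integrable _ X]/(EFin \o _) FE.
rewrite FE; have [_ ->] := independent_Rintegral (XYs2 kl) mF LF
  (fun x => L1Z (c x ^+ 2) (inner x).1).
rewrite -[RHS](Rintegral_prob_cst P 0); apply: eq_Rintegral => w _.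
rewrite /F/= RintegralZl//; last exact: (inner _).1.
rewrite (inner _).2 (same_law_Rintegral (YsY k) (f := fun y => b (X w, y)))//.
by rewrite b0 mul0r mulr0.
Qed.

End monte_carlo.

(** For x <= y the difference is exp(- x) (1 - exp(x - y)), where exp(- x) <= 1 and 1 - exp(x - y)
    <= y - x. *)
Lemma expRN_lipschitz {R : realType} (x y : R) : 0 <= x -> 0 <= y ->
  `|expR (- x) - expR (- y)| <= `|x - y|.
Proof.
wlog xy : x y / x <= y => [h x0 y0|x0 _].
  have [/h|/ltW yx] := leP x y; first exact.
  by rewrite distrC [leRHS]distrC; exact: h.
rewrite ger0_norm; last by rewrite subr_ge0 ler_expR lerN2.
rewrite distrC ger0_norm ?subr_ge0//.
have -> : expR (- x) - expR (- y) = expR (- x) * (1 - expR (x - y)).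
  by rewrite mulrBr mulr1 -expRD; congr (_ - expR _); ring.
have := expR_ge1Dx (x - y).
have : expR (- x) <= 1 by rewrite expR_le1 oppr_le0.
have := expR_ge0 (- x).
have : expR (x - y) <= 1 by rewrite expR_le1 subr_le0.
by nra.
Qed.

(** * Conditional expectations *)

Section conditional_expectation.
Context {R : realType} d {Omega : measurableType d} (P : probability Omega R).
Context d1 {T : measurableType d1} (V : {mfun Omega >-> T}).
Local Notation L1 f := (P.-integrable setT (fun w => (f w)%:E)).
Local Notation sigma_measurable c := (forall B : set R, measurable B ->
  g_sigma_algebra_preimage V (c @^-1` B)).

Let mpre B : measurable B -> measurable (V @^-1` B).
Proof. by move=> mB; rewrite -[X in measurable X]setTI; exact: measurable_funP. Qed.

(* [c1 > c2] is itself an event of the conditioning sigma-algebra. *)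
Lemma sigma_measurable_ae_le (c1 c2 : Omega -> R) :
  sigma_measurable c1 -> sigma_measurable c2 -> L1 c1 -> L1 c2 ->
  (forall B, measurable B ->
    (\int[P]_(w in V @^-1` B) (c1 w)%:E <= \int[P]_(w in V @^-1` B) (c2 w)%:E)%E) ->
  {ae P, forall w, c1 w <= c2 w}.
Proof.
move=> s1 s2 I1 I2 le12.
pose G := g_sigma_algebra_preimageType V.
have m1 : measurable_fun setT (c1 : G -> R) by move=> _ B mB; rewrite setTI; exact: s1.
have m2 : measurable_fun setT (c2 : G -> R) by move=> _ B mB; rewrite setTI; exact: s2.
pose D := [set w | c2 w < c1 w].
have [B mB DB] : g_sigma_algebra_preimage V D.
  have := measurable_funB m1 m2 measurableT (measurable_itv `]0, +oo[).
  rewrite setTI; congr (g_sigma_algebra_preimage V _).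
  by apply/seteqP; split=> w; rewrite /D /= in_itv/= andbT subr_gt0.
rewrite setTI in DB.
have mD : measurable D by rewrite -DB; exact: mpre.
have IB : P.-integrable D (fun w => (c1 w - c2 w)%:E).
  by apply: integrableS (L1B I1 I2).
have : (\int[P]_(w in D) `|(c1 w - c2 w)%:E| = 0)%E.
  apply/eqP; rewrite eq_le integral_ge0// andbT.
  rewrite (eq_integral (fun w => (c1 w)%:E - (c2 w)%:E)%E); last first.
    move=> w; rewrite inE /D/= => wD.
    by rewrite ger0_norm ?subr_ge0 ?EFinB// ltW.
  have [I1D I2D] : P.-integrable D (EFin \o c1) /\ P.-integrable D (EFin \o c2).
    by split; [apply: integrableS I1|apply: integrableS I2].
  rewrite integralB_EFin// leeBlDr ?add0e; last exact: integrable_fin_num.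
  by rewrite -DB; exact: le12.
move/(ae_eq_integral_abs P mD (measurable_int P IB)).
apply: filterS => w /= h; rewrite leNgt; apply/negP => wD.
have /eqP := h wD; rewrite eqe subr_eq0 => /eqP c12.
by move: wD; rewrite c12 ltxx.
Qed.

Lemma is_cond_exp_unique (Y c1 c2 : Omega -> R) :
  is_cond_exp P Y V c1 -> is_cond_exp P Y V c2 -> {ae P, forall w, c1 w = c2 w}.
Proof.
move=> [s1 I1 E1] [s2 I2 E2].
have le12 := sigma_measurable_ae_le s1 s2 I1 I2
  (fun B mB => ltac:(by rewrite E1// E2//)).
have le21 := sigma_measurable_ae_le s2 s1 I2 I1
  (fun B mB => ltac:(by rewrite E1// E2//)).
by apply: filterS2 le12 le21 => w *; apply/le_anti/andP.
Qed.

Lemma cond_exp_is (Y c : Omega -> R) :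
  is_cond_exp P Y V c -> is_cond_exp P Y V (cond_exp P Y V).
Proof.
move=> Yc; apply: (xgetPex (fun=> 0) (P := [set c | is_cond_exp P Y V c])).
by exists c.
Qed.

Lemma cond_exp_ae (Y c : Omega -> R) :
  is_cond_exp P Y V c -> {ae P, forall w, cond_exp P Y V w = c w}.
Proof. by move=> Yc; apply: is_cond_exp_unique (cond_exp_is Yc) Yc. Qed.

Lemma sigma_measurable_comp (f : T -> R) : measurable_fun setT f ->
  sigma_measurable (f \o V).
Proof.
move=> mf B mB; exists (f @^-1` B); last by rewrite setTI.
by rewrite -[X in measurable X]setTI; exact: mf.
Qed.

(** Radon-Nikodym on [T], between the image under [V] of the measure of density |Y| and the law of
    [V]: the version is obtained directly as a function of [V]. The sign hypothesis turns |Y| back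
    into [Y]. *)
Lemma is_cond_exp_exists (Y : Omega -> R) : (forall w, 0 <= Y w) -> L1 Y ->
  exists2 f : T -> R, measurable_fun setT f & is_cond_exp P Y V (f \o V).
Proof.
move=> Y0 IY.
have mV : measurable_fun setT V by exact: measurable_funP.
pose nuV : {charge set T -> \bar R} :=
  pushforward (induced_charge (integrable_abse IY)) V.
pose nu := nuV mV.
have numu : nu `<< distribution P V.
  exact/dominates_pushforward/dominates_induced.
pose f := Radon_Nikodym nu (distribution P V).
have If := Radon_Nikodym_integrable numu.
have mf := measurable_int _ If.
have fE x : (fine (f x))%:E = f x by rewrite fineK//; exact: Radon_Nikodym_fin_num.
have IfV : L1 ((fine \o f) \o V).
  rewrite /comp; under eq_fun do rewrite fE.
  apply/integrableP; split; first exact: measurableT_comp.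
  have /integrableP[_] := If; rewrite integral_distribution_comp//.
  exact: measurableT_comp.
exists (fine \o f); first exact: measurableT_comp.
split => //; first by apply: sigma_measurable_comp; exact: measurableT_comp.
move=> B mB; rewrite /=; under eq_integral do rewrite fE.
transitivity (\int[distribution P V]_(x in B) f x)%E.
  rewrite integral_pushforward//.
  apply: (integrableS measurableT) => //; first exact: mpre.
  by move: IfV; rewrite /comp; under eq_fun do rewrite fE.
have <- : nu B = (\int[distribution P V]_(x in B) f x)%E.
  exact: Radon_Nikodym_integral.
apply: eq_integral => w _; rewrite /= ger0_norm//.
Qed.

(* Boundedness of the version makes the conditional variance exist; without  *)
(* it [cond_var] could be the default value [0].                             *)
Lemma is_cond_exp_exists01 (Y : Omega -> R) : (forall w, 0 <= Y w <= 1) ->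
  measurable_fun setT Y ->
  exists f : T -> R, [/\ measurable_fun setT f, (forall x, 0 <= f x <= 1) &
    is_cond_exp P Y V (f \o V)].
Proof.
move=> Y01 mY.
have Y0 w : 0 <= Y w by case/andP: (Y01 w).
have IY : L1 Y by exact: L1_01.
have [f mf [sf If fE]] := is_cond_exp_exists Y0 IY.
(* Truncation alters the version on a null set only, since both bounds hold almost surely for
   [f \o V]. *)
pose g x := Num.max 0 (Num.min (f x) 1).
have mg : measurable_fun setT g by apply: measurable_maxr => //; exact: measurable_minr.
have g01 x : 0 <= g x <= 1.
  by rewrite /g le_max lexx/= ge_max ler01 ge_min lexx orbT.
have mc (c : R) : sigma_measurable (fun=> c).
  by apply: (sigma_measurable_comp (f := fun=> c)).
have f_ge0 : {ae P, forall w, 0 <= f (V w)}.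
  apply: (sigma_measurable_ae_le (mc 0) sf (L1_cst P 0) If) => B mB.
  rewrite fE// integral0_eq//; apply: integral_ge0 => w _.
  by rewrite lee_fin.
have f_le1 : {ae P, forall w, f (V w) <= 1}.
  apply: (sigma_measurable_ae_le sf (mc 1) If (L1_cst P 1)) => B mB.
  rewrite fE//; apply: ge0_le_integral => //.
  - exact: mpre.
  - by move=> w _; rewrite lee_fin.
  - by apply/measurable_EFinP/measurable_funTS.
  - by move=> w _; rewrite lee_fin; case/andP: (Y01 w).
exists g; split => //; split.
- exact: sigma_measurable_comp.
- by apply: L1_01 => [|w]; [exact: measurableT_comp|exact: g01].
- move=> B mB; rewrite -fE//; apply: ae_eq_integral.
  + exact: mpre.
  + by apply/measurable_EFinP/measurable_funTS/(measurableT_comp mg).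
  + exact/measurable_funTS/(measurable_int P If).
  + apply: filterS2 f_ge0 f_le1 => w f0 f1 _.
    by rewrite /= /g; congr EFin; rewrite (min_idPl f1) (max_idPr f0).
Qed.

Import HBNNSimple.

Let integral_nnsfun_comp (Z : Omega -> \bar R) (h : {nnsfun T >-> R}) :
  measurable_fun setT Z -> (forall w, 0 <= Z w)%E ->
  (\int[P]_w ((h (V w))%:E * Z w) =
   \sum_(r \in range h) (r%:E * \int[P]_(w in V @^-1` (h @^-1` [set r])) Z w))%E.
Proof.
move=> mZ Z0.
have mh r : measurable (V @^-1` (h @^-1` [set r])).
  by apply: mpre; rewrite -[X in measurable X]setTI; exact: measurable_funP.
transitivity (\int[P]_w (\sum_(r \in range h)
    (r%:E * (Z \_ (V @^-1` (h @^-1` [set r]))) w)))%E.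
  apply: eq_integral => w _; rewrite fimfunE -fsumEFin// ge0_mule_fsuml.
    apply: eq_fsbigr => r _; rewrite EFinM -muleA; congr (_ * _)%E.
    by rewrite epatch_indic muleC.
  by move=> r; exact: nnfun_muleindic_ge0.
have mZr r : measurable_fun setT (Z \_ (V @^-1` (h @^-1` [set r]))).
  by apply/(measurable_restrictT _ _).1 => //; exact: measurable_funTS.
have Zr0 r w : (0 <= (Z \_ (V @^-1` (h @^-1` [set r]))) w)%E by exact: erestrict_ge0.
have rZ0 r w : (0 <= r%:E * (Z \_ (V @^-1` (h @^-1` [set r]))) w)%E.
  have [r0|r0] := leP 0 r; first by rewrite mule_ge0.
  (* A negative [r] is not a value of [h], so its level set is empty. *)
  rewrite patchE memNset ?mule0// => /= hr.
  by move: r0; rewrite -hr ltNge fun_ge0.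
rewrite ge0_integral_fsum//; last first.
  by move=> r; exact: emeasurable_funM.
apply: eq_fsbigr => r; rewrite inE => -[t _ <-].
rewrite ge0_integralZl//; last by rewrite lee_fin.
by rewrite [in RHS]integral_mkcond.
Qed.

(** The comparison on events of [V] extends by linearity to simple weights, and then to [k] by
    monotone convergence. *)
Lemma le_integral_comp (Z1 Z2 : Omega -> R) (k : T -> R) :
  measurable_fun setT Z1 -> measurable_fun setT Z2 ->
  (forall w, 0 <= Z1 w) -> (forall w, 0 <= Z2 w) ->
  measurable_fun setT k -> (forall x, 0 <= k x) ->
  (forall B, measurable B ->
    (\int[P]_(w in V @^-1` B) (Z1 w)%:E <= \int[P]_(w in V @^-1` B) (Z2 w)%:E)%E) ->
  (\int[P]_w (k (V w) * Z1 w)%:E <= \int[P]_w (k (V w) * Z2 w)%:E)%E.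
Proof.
move=> mZ1 mZ2 Z10 Z20 mk k0 le12.
have mE : measurable_fun setT (EFin \o k) by exact/measurable_EFinP.
pose h := nnsfun_approx measurableT mE.
have h_nd x : {homo (fun n => h n x) : m n / (m <= n)%N >-> m <= n}.
  by move=> m n mn; exact/lefP/nd_nnsfun_approx.
have lim_h (Z : Omega -> R) : measurable_fun setT Z -> (forall w, 0 <= Z w) ->
    ((\int[P]_w ((h n (V w))%:E * (Z w)%:E))%E @[n --> \oo] -->
     \int[P]_w (k (V w) * Z w)%:E)%E.
  move=> mZ Z0.
  rewrite (eq_integral (fun w => limn (fun n => (h n (V w))%:E * (Z w)%:E)%E)).
    apply: cvg_monotone_convergence => //.
    - move=> n; apply: emeasurable_funM; last exact/measurable_EFinP.
      by apply/measurable_EFinP; exact: measurableT_comp.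
    - by move=> n w _; rewrite mule_ge0 ?lee_fin.
    - by move=> w _ m n mn; rewrite lee_wpmul2r ?lee_fin//; exact: h_nd.
  move=> w _; apply/esym/cvg_lim => //; rewrite EFinM; apply: cvgeZr => //.
  by apply: (cvg_nnsfun_approx measurableT mE) => // x _; rewrite lee_fin.
have h1 := lim_h _ mZ1 Z10; have h2 := lim_h _ mZ2 Z20.
rewrite -(cvg_lim _ h1)// -(cvg_lim _ h2)//.
apply: lee_lim; [exact: cvgP h1|exact: cvgP h2|apply: nearW => n].
rewrite !(integral_nnsfun_comp (h n)) //.
- apply: lee_fsum => // r [t _ <-].
  by rewrite lee_wpmul2l ?lee_fin// le12.
- exact/measurable_EFinP.
- exact/measurable_EFinP.
Qed.

End conditional_expectation.

(** * Products of independent variables *)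

Section independent_products.
Context {R : realType} d {Omega : measurableType d} (P : probability Omega R).
Context (I : finType) (dI : I -> measure_display)
  (T : forall i, measurableType (dI i)).
Local Notation L1 f := (P.-integrable setT (fun w => (f w)%:E)).

Lemma mutually_independent_sub (X : forall i, Omega -> T i) (A : {set I}) :
  mutually_independent P X ->
  mutually_independent P (fun i : {i | i \in A} => X (sval i)).
Proof.
move=> indX J B mB.
(* Outside [A] the quantification is vacuous and [B' i] is the whole space; inside [A], irrelevance
   of membership proofs gives back [B]. *)
pose B' i : set (T i) := [set x : T i | forall h : i \in A, B (exist _ i h) x].
have B'E (i : {i | i \in A}) : B' (sval i) = B i.
  case: i => i iA; apply/seteqP; split => x /=; first exact.
  by move=> Bx h; rewrite (bool_irrelevance h iA).
have mB' i : measurable (B' i).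
  have [iA|iA] := boolP (i \in A).
    by rewrite (B'E (exist _ i iA)); exact: mB.
  rewrite (_ : B' i = setT)//; apply/seteqP; split => // x _ h.
  by rewrite h in iA.
have := indX [set sval i | i in J]%SET B' mB'.
rewrite big_imset/=; last by move=> i j _ _; exact: val_inj.
under eq_bigr do rewrite B'E.
move=> <-; congr (P _); apply/seteqP; split => w h i.
  by move=> /= /imsetP[j jJ ->]; rewrite /= B'E; exact: h.
by move=> iJ; rewrite /= -B'E; apply: h; apply/imsetP; exists i.
Qed.

Variables (X : forall i, {mfun Omega >-> T i}) (Z : forall i, T i -> R).
Arguments Z i : clear implicits.
Hypothesis indX : mutually_independent P (fun i => X i : Omega -> T i).
Hypothesis mZ : forall i, measurable_fun setT (Z i).

Let W (s : seq I) w := \prod_(i <- s) Z i (X i w).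

Let mW s : measurable_fun setT (W s).
Proof.
by apply: measurable_prod => i _; exact: (measurableT_comp (@mZ i)).
Qed.

Let Wm s : {mfun Omega >-> R} :=
  HB.pack (W s) (isMeasurableFun.Build _ _ _ _ (W s) (mW s)).

Let mpre i B : measurable B -> measurable (X i @^-1` B).
Proof. by move=> mB; rewrite -[X in measurable X]setTI; exact: measurable_funP. Qed.

(** The variables outside the product enter through arbitrary events, so that the induction can move
    the head of [s] from the product to the list of events. *)
Let indep_prod_event (s s' : seq I) (B : forall i, set (T i)) (C : set R) :
  uniq (s ++ s') -> (forall i, measurable (B i)) -> measurable C ->
  P (W s @^-1` C `&` \big[setI/setT]_(i <- s') (X i @^-1` B i)) =
  (P (W s @^-1` C) * P (\big[setI/setT]_(i <- s') (X i @^-1` B i)))%E.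
Proof.
elim: s s' B C => [|i s ih] s' B C.
  move=> _ mB mC; rewrite /W.
  have -> : (fun w => \prod_(i <- [::]) Z i (X i w)) @^-1` C =
      if 1 \in C then setT else set0.
    apply/seteqP; split => w /=; rewrite big_nil; case: ifPn; rewrite ?inE//.
    by rewrite notin_setE.
  by case: ifP => _; rewrite ?setTI ?set0I ?probability_setT ?mul1e ?measure0 ?mul0e.
rewrite /= mem_cat negb_or => /andP[/andP[is_ is'] us] mB mC.
have us' : uniq s' by move: us; rewrite cat_uniq => /and3P[].
have uiss : uniq (s ++ i :: s').
  move: us; rewrite !cat_uniq /= negb_or => /and3P[-> hs ->].
  by rewrite is_ is' /= andbT.
pose E := \big[setI/setT]_(j <- s') (X j @^-1` B j).
have mE : measurable E.
  by apply: big_rec => // j F _ mF; apply: measurableI => //; exact: mpre.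
have := @independent_pair_event _ _ _ P _ _ _ _ (X i) (Wm s) E mE.
have WE : W (i :: s) = (fun z => Z i z.1 * z.2) \o pairRV (X i) (Wm s).
  by apply/funext => w; rewrite /W /= big_cons.
have mf : measurable_fun setT (fun z : T i * R => Z i z.1 * z.2).
  by apply: measurable_funM => //; exact: (measurableT_comp (@mZ i)).
move=> h; rewrite WE.
apply: (h _ ((fun z : T i * R => Z i z.1 * z.2) @^-1` C)); last first.
  by rewrite -[X in measurable X]setTI; exact: mf.
move=> A1 A2 mA1 mA2.
(* [B] is changed at [i] only; as [i] is not in [s'], the event [E] stays the same. *)
pose B' := eqtype.dfwith B A1.
have B'i : B' i = A1 by exact: dfwith_in.
have B'j j : j != i -> B' j = B j by move=> ji; rewrite /B' dfwith_out// eq_sym.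
have mB' j : measurable (B' j).
  have [->|ji] := eqVneq j i; first by rewrite B'i.
  by rewrite B'j.
have EB' : \big[setI/setT]_(j <- s') (X j @^-1` B' j) = E.
  apply: eq_big_seq => j js'; rewrite B'j//.
  by apply: contraNneq is' => <-.
have h1 := ih (i :: s') B' A2 uiss mB' mA2.
have h2 := ih [:: i] B' A2 _ mB' mA2.
rewrite big_cons EB' B'i in h1; rewrite big_cons big_nil setIT B'i in h2.
have h3 : P (X i @^-1` A1 `&` E) = (P (X i @^-1` A1) * P E)%E.
  have := @mutually_independent_seq _ _ _ P _ _ _ _ [:: i & s'] B' indX.
  rewrite /= is' us' big_cons EB' B'i big_cons => /(_ isT mB') ->.
  rewrite B'i; congr (_ * _)%E.
  rewrite -(@mutually_independent_seq _ _ _ P _ _ _ _ s' B' indX us' mB').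
  by rewrite EB'.
rewrite [X in P X](_ : _ = W s @^-1` A2 `&` (X i @^-1` A1 `&` E)); last first.
  by rewrite setIA [X in X `&` E]setIC.
rewrite h1 h3 muleA [X i @^-1` A1 `&` _]setIC h2//.
by rewrite cats1 rcons_uniq is_; move: us; rewrite cat_uniq => /and3P[].
Qed.

Lemma independent_Rintegral_prod (s : seq I) : uniq s ->
  (forall i, L1 (fun w => Z i (X i w))) ->
  L1 (fun w => \prod_(i <- s) Z i (X i w)) /\
  \int[P]_w (\prod_(i <- s) Z i (X i w)) = \prod_(i <- s) \int[P]_w Z i (X i w).
Proof.
move=> + IZ; elim: s => [_|i s ih /= /andP[is_ us]].
  under eq_fun do rewrite big_nil; rewrite big_nil; split; first exact: L1_cst.
  under eq_Rintegral do rewrite big_nil.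
  exact: Rintegral_prob_cst.
have [IW WE] := ih us.
have iW : independent P (X i) (Wm s).
  apply: independentC => A B mA mB.
  have := @indep_prod_event s [:: i] (eqtype.dfwith (fun=> setT) B) A.
  rewrite big_cons big_nil setIT dfwith_in; apply => //.
    by rewrite cats1 rcons_uniq is_ us.
  move=> j; have [->|ji] := eqVneq j i; first by rewrite dfwith_in.
  by rewrite dfwith_out// eq_sym.
have [h1 h2] := independent_RintegralM iW (@mZ i) (@measurable_id _ _ setT) (IZ i) IW.
rewrite big_cons -WE -h2; split.
  by under eq_fun do rewrite big_cons.
by apply: eq_Rintegral => w _; rewrite big_cons.
Qed.

End independent_products.

Section variances.
Context {R : realType} d {Omega : measurableType d} (P : probability Omega R).
Local Notation L1 f := (P.-integrable setT (fun w => (f w)%:E)).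

Lemma expectation_Rintegral (X : Omega -> R) : L1 X ->
  'E_P[X]%E = (\int[P]_w X w)%:E.
Proof. by move=> IX; rewrite unlock EFin_Rintegral. Qed.

Lemma variance_Rintegral (X : Omega -> R) (th : R) : L1 X ->
  \int[P]_w X w = th -> L1 (fun w => (X w - th) ^+ 2) ->
  'V_P[X]%E = (\int[P]_w (X w - th) ^+ 2)%:E.
Proof.
move=> IX Xth I2; rewrite /variance unlock (expectation_Rintegral IX) Xth.
by rewrite -expectation_Rintegral.
Qed.

Lemma eq_variance_ae (X Y : Omega -> R) : L1 X -> L1 Y ->
  {ae P, forall w, X w = Y w} -> 'V_P[X]%E = 'V_P[Y]%E.
Proof.
move=> IX IY XY; have mX := L1_measurable IX; have mY := L1_measurable IY.
have E : \int[P]_w X w = \int[P]_w Y w.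
  congr fine; apply: ae_eq_integral => //; [exact/measurable_EFinP..|].
  by apply: filterS XY => w -> _.
rewrite /variance unlock (expectation_Rintegral IX) (expectation_Rintegral IY) E.
rewrite unlock; apply: ae_eq_integral => //.
- apply/measurable_EFinP.
  by apply: measurable_funM; exact: measurable_funB.
- apply/measurable_EFinP.
  by apply: measurable_funM; exact: measurable_funB.
- by apply: filterS XY => w e _ /=; rewrite !fctE /= e.
Qed.

End variances.

Section four_coordinates.
Context d1 d2 d3 {T : measurableType d1} {S : measurableType d2}
  {E : measurableType d3} (x : {mfun T >-> S}) (y : {mfun T >-> E}).

(** With [x] the subvector map and [y] the random set map, this is the conditioning variable of
    sigma_3^2 as a function of (U, U'). *)
Definition four_coordinates (z : T * T) : S * S * E * E :=
  (x z.1, x z.2, y z.1, y z.2).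

Lemma measurable_four_coordinates : measurable_fun setT four_coordinates.
Proof.
apply: measurable_fun_pair; last exact: measurableT_comp.
apply: measurable_fun_pair; last exact: measurableT_comp.
by apply: measurable_fun_pair; exact: measurableT_comp.
Qed.

HB.instance Definition _ :=
  isMeasurableFun.Build _ _ _ _ four_coordinates measurable_four_coordinates.

Lemma measurable_first_coordinates {R : realType} (K : S * S -> R) :
  measurable_fun setT K ->
  measurable_fun setT (fun z : S * S * E * E => K z.1.1).
Proof.
move=> mK; apply: (measurableT_comp mK).
exact: (measurableT_comp measurable_fst measurable_fst).
Qed.

End four_coordinates.

(** * Conditioning on a function of one of two independent variables *)

Section conditioning_on_a_function.
Context {R : realType} d {Omega : measurableType d} (P : probability Omega R).
Context d1 d2 d3 {T1 : measurableType d1} {T2 : measurableType d2}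
  {T : measurableType d3}.
Local Notation L1 f := (P.-integrable setT (fun w => (f w)%:E)).
Variables (X : {mfun Omega >-> T1}) (Y : {mfun Omega >-> T2}).
Hypothesis XY : independent P X Y.
Variable v : {mfun T1 >-> T}.

Let mvX B : measurable B -> measurable ((v \o X) @^-1` B).
Proof.
move=> mB; rewrite -[X in measurable X]setTI.
exact: (measurable_funP (v \o X : {mfun Omega >-> T})).
Qed.

Let integral_event (f : Omega -> R) B : measurable B ->
  (\int[P]_(w in (v \o X) @^-1` B) (f w)%:E =
   \int[P]_w (\1_B (v (X w)) * f w)%:E)%E.
Proof.
move=> mB; rewrite integral_mkcond; apply: eq_integral => w _.
rewrite patchE indicE; case: ifPn => wB.
  by move: wB; rewrite inE /= => wB; rewrite mem_set// mul1r.
by rewrite memNset ?mul0r//; move: wB; rewrite notin_setE.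
Qed.

Let L1_event (f : Omega -> R) B : measurable B -> L1 f ->
  L1 (fun w => \1_B (v (X w)) * f w).
Proof.
move=> mB If; apply: (L1_dominated _ (integrable_norm If)).
  apply: measurable_funM; last exact: L1_measurable If.
  by apply: measurableT_comp => //; exact: measurableT_comp.
move=> w; rewrite normrM ler_piMl//= indicE.
by case: (_ \in _); rewrite ?normr1 ?normr0 ?ler01.
Qed.

(** Freezing lemma: [Y] is integrated out with [X] fixed. As the result factors through [v], it is
    already the conditional expectation given the coarser [v \o X]. *)
Lemma is_cond_exp_independent (f : T1 * T2 -> R) (g : T -> R) :
  measurable_fun setT f -> L1 (fun w => f (X w, Y w)) ->
  (forall x, L1 (fun w => f (x, Y w))) -> measurable_fun setT g ->
  (forall x, g (v x) = \int[P]_w f (x, Y w)) ->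
  is_cond_exp P (fun w => f (X w, Y w)) (v \o X) (g \o (v \o X)).
Proof.
move=> mf If Ifx mg gE.
have [Ig _] := independent_Rintegral XY mf If Ifx.
have Ig' : L1 (fun w => g (v (X w))) by under eq_fun do rewrite gE.
split => //.
  exact: (@sigma_measurable_comp _ _ _ _ _ (v \o X : {mfun Omega >-> T})).
move=> B mB; rewrite !integral_event// -!EFin_Rintegral; [|exact: L1_event..].
congr EFin; pose F (z : T1 * T2) := \1_B (v z.1) * f z.
have mF : measurable_fun setT F.
  apply: measurable_funM => //; apply: measurableT_comp => //.
  exact: measurableT_comp.
have IF : L1 (fun w => F (X w, Y w)) by exact: L1_event.
have IFx x : L1 (fun w => F (x, Y w)) by exact: (L1Z (\1_B (v x)) (Ifx x)).
have [_ E] := independent_Rintegral XY mF IF IFx.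
apply/esym; apply: (etrans E); apply: eq_Rintegral => w _.
rewrite /F/= RintegralZl//; last exact: Ifx.
by rewrite /= gE.
Qed.

Variable F : T1 * T2 -> R.
Hypotheses (mF : measurable_fun setT F) (F01 : forall z, 0 <= F z <= 1).

Let mFx x : measurable_fun setT (fun y => F (x, y)).
Proof. exact: measurableT_comp. Qed.

Let LFx x : L1 (fun w => F (x, Y w)).
Proof.
by apply: L1_01 => //; exact: (measurableT_comp (@mFx x)).
Qed.

Let p x := \int[P]_w F (x, Y w).
Let q x := \int[P]_w ((F (x, Y w) - p x) ^+ 2).

Let mp : measurable_fun setT p.
Proof. exact: measurable_fun_integral_snd. Qed.

Let p01 x : 0 <= p x <= 1.
Proof.
by apply: Rintegral01 => //; exact: (measurableT_comp (@mFx x)).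
Qed.

Let sqrB01 (s t : R) : 0 <= s <= 1 -> 0 <= t <= 1 -> 0 <= (s - t) ^+ 2 <= 1.
Proof.
move=> /andP[s0 s1] /andP[t0 t1]; rewrite sqr_ge0/= -(real_normK (num_real _)).
by rewrite expr_le1// ler_norml; apply/andP; split; lra.
Qed.

Let L1sqr x t : 0 <= t <= 1 -> L1 (fun w => (F (x, Y w) - t) ^+ 2).
Proof.
move=> t01; apply: L1_01 => [|w]; last exact: sqrB01.
apply: measurable_funX; apply: measurable_funB => //.
exact: (measurableT_comp (@mFx x)).
Qed.

(** The mean is the best constant predictor. The value used for [t] is the conditional expectation
    given [v \o X], a less informed predictor. *)
Let bias_variance x t : 0 <= t <= 1 ->
  q x <= \int[P]_w ((F (x, Y w) - t) ^+ 2).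
Proof.
move=> t01.
have -> : \int[P]_w ((F (x, Y w) - t) ^+ 2) = q x + (p x - t) ^+ 2.
  transitivity (\int[P]_w ((F (x, Y w) - p x) ^+ 2 +
      (2 * (p x - t) * (F (x, Y w) - p x) + (p x - t) ^+ 2))).
    by apply: eq_Rintegral => w _; ring.
  have Ib : L1 (fun w => F (x, Y w) - p x) by apply: L1B => //; exact: L1_cst.
  rewrite RintegralD//; [|exact/L1sqr/p01|by apply: L1D; [exact: L1Z|exact: L1_cst]].
  rewrite RintegralD//; [|exact: L1Z|exact: L1_cst].
  rewrite RintegralZl// RintegralB//; [|exact: LFx|exact: L1_cst].
  by rewrite !Rintegral_prob_cst subrr mulr0 add0r.
by rewrite lerDl sqr_ge0.
Qed.

(* The conditional variance given [v(X)] dominates on average the one given  *)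
(* [X].  For the theorem this inequality suffices, and it spares proving     *)
(* that the distance of two random sets is jointly measurable on [Lstar].    *)
Lemma le_cond_var_integral (k : T -> R) : measurable_fun setT k ->
  (forall t, 0 <= k t) ->
  (\int[P]_w (k (v (X w)) * q (X w))%:E <=
   \int[P]_w (k (v (X w)) *
     cond_var P (fun w => F (X w, Y w)) (v \o X) w)%:E)%E.
Proof.
move=> mk k0; pose V : {mfun Omega >-> T} := v \o X.
pose Z w := F (X w, Y w).
have mXY : measurable_fun setT (fun w => (X w, Y w)) by exact: measurable_fun_pair.
have mZ : measurable_fun setT Z by exact: (measurableT_comp mF mXY).
have [f1 [mf1 f101 f1E]] := is_cond_exp_exists01 P V (fun w => F01 (X w, Y w)) mZ.
have c1 := cond_exp_ae f1E.
have mc1 : measurable_fun setT (cond_exp P Z V).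
  by have [_ I _] := cond_exp_is f1E; exact: L1_measurable I.
pose W w := (Z w - f1 (V w)) ^+ 2.
have mW : measurable_fun setT W.
  by apply: measurable_funX; apply: measurable_funB => //; exact: measurableT_comp.
have [f2 [mf2 f201 f2E]] :=
  is_cond_exp_exists01 P V (fun w => sqrB01 (F01 (X w, Y w)) (f101 (V w))) mW.
(* [cond_var] is built on the chosen version [cond_exp P Z V], which agrees with [f1 \o V] only
   almost surely. *)
have f2E' : is_cond_exp P (fun w => (Z w - cond_exp P Z V w) ^+ 2) V (f2 \o V).
  have [sf2 If2 Ef2] := f2E; split => // B mB; rewrite Ef2//.
  apply: ae_eq_integral.
  - exact: mvX.
  - exact/measurable_EFinP/measurable_funTS.
  - apply/measurable_EFinP/measurable_funTS.
    by apply: measurable_funX; exact: measurable_funB.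
  - by apply: filterS c1 => w + _ /= => ->.
have c2 := cond_exp_ae f2E'.
have mc2 : measurable_fun setT (cond_var P Z V).
  by have [_ I _] := cond_exp_is f2E'; exact: L1_measurable I.
have -> : (\int[P]_w (k (v (X w)) * cond_var P Z V w)%:E =
    \int[P]_w (k (V w) * f2 (V w))%:E)%E.
  have mkV : measurable_fun setT (fun w => k (V w)) by exact: measurableT_comp.
  apply: ae_eq_integral => //.
  - exact/measurable_EFinP/measurable_funM.
  - apply/measurable_EFinP/measurable_funM => //; exact: measurableT_comp.
  - by apply: filterS c2 => w + _ /=; rewrite /cond_var => ->.
have mq : measurable_fun setT q.
  apply: (measurable_fun_integral_snd P Y (F := fun z => (F z - p z.1) ^+ 2)).
  apply: measurable_funX; apply: measurable_funB => //.
  exact: measurableT_comp.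
have q01 x : 0 <= q x <= 1.
  apply: Rintegral01 => [|w]; last exact: sqrB01.
  apply: measurable_funX; apply: measurable_funB => //.
  exact: (measurableT_comp (@mFx x)).
have Iq : L1 (fun w => q (X w)).
  apply: L1_01 => [|w]; last exact: q01.
  exact: (measurableT_comp mq (measurable_funP X)).
(* It remains to compare on events of [V], where [f2 \o V] may be replaced by [W] and [Y] integrated
   out pointwise in [X]. *)
apply: (le_integral_comp (V := V) (Z1 := q \o X) (Z2 := f2 \o V) _ _ _ _ mk k0).
- exact: (measurableT_comp mq (measurable_funP X)).
- exact: (measurableT_comp mf2 (measurable_funP V)).
- by move=> w; case/andP: (q01 (X w)).
- by move=> w; case/andP: (f201 (V w)).
move=> B mB; have [_ _ ->//] := f2E.
have IW : L1 W.
  by apply: L1_01 => // w; exact: (sqrB01 (F01 (X w, Y w)) (f101 (V w))).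
rewrite !integral_event// -!EFin_Rintegral; [|exact: L1_event..].
rewrite lee_fin.
pose J (z : T1 * T2) := \1_B (v z.1) * (F z - f1 (v z.1)) ^+ 2.
have mJ : measurable_fun setT J.
  apply: measurable_funM; first by do 2 apply: measurableT_comp => //.
  apply: measurable_funX; apply: measurable_funB => //.
  by do 2 apply: measurableT_comp => //.
have IJ : L1 (fun w => J (X w, Y w)) by exact: L1_event.
have IJx x : L1 (fun w => J (x, Y w)).
  exact: (L1Z (\1_B (v x)) (L1sqr x (f101 (v x)))).
have [IE E] := independent_Rintegral XY mJ IJ IJx.
rewrite [leRHS]E; apply: le_Rintegral => //; first exact: L1_event.
move=> w _; rewrite /J/= RintegralZl//; last exact: L1sqr.
by rewrite ler_wpM2l// bias_variance.
Qed.

End conditioning_on_a_function.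

(** * The nested estimator *)

Section nested_estimator.
Context {R : realType} d {Omega : measurableType d} (P : probability Omega R).
Context d1 d2 {T : measurableType d1} {T2 : measurableType d2}.
Local Notation L1 f := (P.-integrable setT (fun w => (f w)%:E)).
Variables (U U' : {mfun Omega >-> T}) (Y : {mfun Omega >-> T2}).
Hypotheses (UU' : independent P U U') (U'U : same_law P U' U).
Variables (n m : nat) (n2 : (2 <= n)%N) (m1 : (1 <= m)%N).
Variables (Us : 'I_n -> {mfun Omega >-> T}) (Ys : 'I_m -> {mfun Omega >-> T2}).
Hypotheses (UsU : forall i, same_law P (Us i) U)
  (indUs : mutually_independent P Us).
Hypotheses (YsY : forall k, same_law P (Ys k) Y)
  (indYs : mutually_independent P Ys).
Hypotheses (UsYs : forall i j k, independent P (pairRV (Us i) (Us j)) (Ys k))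
  (UsYs2 : forall i j k l,
     independent P (pairRV (Us i) (Us j)) (pairRV (Ys k) (Ys l))).
Variables (kap : T * T -> R) (F : (T * T) * T2 -> R) (L : R).
Hypotheses (mkap : measurable_fun setT kap) (mF : measurable_fun setT F).
Hypotheses (skap : forall x y, kap (x, y) = kap (y, x))
  (sF : forall x y z, F ((x, y), z) = F ((y, x), z)).
Hypotheses (F01 : forall z, 0 <= F z <= 1) (L0 : 0 <= L).
Hypothesis kap2 : L1 (fun w => kap (U w, U' w) ^+ 2).
Hypothesis kap2x : forall x, L1 (fun w => kap (x, U w) ^+ 2).

(** For [F] the indicator of a symmetric difference, [x] is a pair of inputs and this is the
    normalised volume separating their two sets. *)
Definition miss_probability x := \int[P]_w F (x, Y w).
Local Notation p := miss_probability.
Definition weighted_kernel x := kap x * expR (- (L * p x)).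
Local Notation f := weighted_kernel.

Let th := \int[P]_w f (U w, U' w).
Let g x := \int[P]_w f (x, U w).
Let s1 := \int[P]_w ((f (U w, U' w) - th) ^+ 2).
Let s2 := \int[P]_w ((g (U w) - th) ^+ 2).
Let s3 := \int[P]_w (kap (U w, U' w) ^+ 2 *
  \int[P]_w' ((F ((U w, U' w), Y w') - p (U w, U' w)) ^+ 2)).
(** Inverse of the number of pairs i < j, as [sum1] records. *)
Let c : R := 2 / (n%:R * (n%:R - 1)).
Let hat w := c * \sum_(i < n) \sum_(j < n | (i < j)%N)
  kap (Us i w, Us j w) *
  expR (- (L * (m%:R^-1 * \sum_(k < m) F ((Us i w, Us j w), Ys k w)))).
Let ust w := c * \sum_(i < n) \sum_(j < n | (i < j)%N) f (Us i w, Us j w).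

Let mFx x : measurable_fun setT (fun y => F (x, y)).
Proof. exact: measurableT_comp. Qed.

Let LFx x (Z : {mfun Omega >-> T2}) : L1 (fun w => F (x, Z w)).
Proof.
by apply: L1_01 => //; exact: (measurableT_comp (@mFx x)).
Qed.

Lemma miss_probability01 x : 0 <= p x <= 1.
Proof.
by apply: Rintegral01 => //; exact: (measurableT_comp (@mFx x)).
Qed.

Lemma measurable_miss_probability : measurable_fun setT p.
Proof. exact: measurable_fun_integral_snd. Qed.

Lemma measurable_expRN_miss_probability :
  measurable_fun setT (fun x => expR (- (L * p x))).
Proof.
apply: measurableT_comp => //; apply: measurableT_comp => //.
by apply: measurable_funM => //; exact: measurable_miss_probability.
Qed.

Lemma measurable_weighted_kernel : measurable_fun setT f.
Proof. exact: (measurable_funM mkap measurable_expRN_miss_probability). Qed.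

Let expRN01 x : 0 <= x -> 0 <= expR (- (L * x)) <= 1.
Proof. by move=> x0; rewrite expR_ge0/= expR_le1 oppr_le0 mulr_ge0. Qed.

Lemma weighted_kernel_sqr_le x : f x ^+ 2 <= kap x ^+ 2.
Proof.
have /andP[p0 _] := miss_probability01 x; have /andP[e0 e1] := expRN01 p0.
by rewrite exprMn ler_piMr ?sqr_ge0// expr_le1.
Qed.

Let L1f2 : L1 (fun w => f (U w, U' w) ^+ 2).
Proof.
apply: (L1_dominated _ kap2).
  apply: measurable_funX; apply: (measurableT_comp measurable_weighted_kernel).
  exact: measurable_fun_pair.
by move=> w; rewrite ger0_norm ?sqr_ge0//; exact: weighted_kernel_sqr_le.
Qed.

Let mfx x : measurable_fun setT (fun y => f (x, y)).
Proof. exact: (measurableT_comp measurable_weighted_kernel). Qed.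

Let L1f2x x : L1 (fun w => f (x, U w) ^+ 2).
Proof.
apply: (L1_dominated _ (kap2x x)).
  by apply: measurable_funX; apply: (measurableT_comp (@mfx x)).
by move=> w; rewrite ger0_norm ?sqr_ge0//; exact: weighted_kernel_sqr_le.
Qed.

Let n_gt1 : 1 < n%:R :> R. Proof. by rewrite ltr1n. Qed.

Let sum1 : \sum_(i < n) \sum_(j < n | (i < j)%N) (1 : R) = c^-1.
Proof.
have := @sum_triangle R n (fun _ _ => 1) (fun _ _ => erefl).
under eq_bigr do rewrite sum_neq mulr1.
rewrite sumr_const card_ord -[LHS]mulr_natl => e.
by rewrite /c invf_div e; field.
Qed.

Let c_gt0 : 0 < c.
Proof. by rewrite divr_gt0// mulr_gt0 ?subr_gt0// (lt_trans ltr01). Qed.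

(** Convexity of the square, from the nonnegative spread around the mean [M]. All pairs share the
    same Monte Carlo points, so their errors are correlated; averaging the squares avoids computing
    these correlations. *)
Let mean_sqr (D : 'I_n -> 'I_n -> R) :
  (c * \sum_(i < n) \sum_(j < n | (i < j)%N) D i j) ^+ 2 <=
  c * \sum_(i < n) \sum_(j < n | (i < j)%N) D i j ^+ 2.
Proof.
set M := c * _.
have : 0 <= \sum_(i < n) \sum_(j < n | (i < j)%N) (D i j - M) ^+ 2.
  by do 2 (apply: sumr_ge0 => ? _); exact: sqr_ge0.
have -> : \sum_(i < n) \sum_(j < n | (i < j)%N) (D i j - M) ^+ 2 =
    \sum_(i < n) \sum_(j < n | (i < j)%N) D i j ^+ 2 - 2 * M * (c^-1 * M)
    + M ^+ 2 * c^-1.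
  have -> : c^-1 * M = \sum_(i < n) \sum_(j < n | (i < j)%N) D i j.
    by rewrite /M mulKf// gt_eqF.
  rewrite -sum1 !mulr_sumr -sumrB -big_split/=.
  apply: eq_bigr => i _; rewrite !mulr_sumr -sumrB -big_split/=.
  by apply: eq_bigr => j _; ring.
set S := \sum_(i < n) _ => S0.
have : 0 <= c * (S - 2 * M * (c^-1 * M) + M ^+ 2 * c^-1) by rewrite mulr_ge0// ltW.
rewrite (_ : c * _ = c * S - M ^+ 2) ?subr_ge0//.
by field; rewrite gt_eqF.
Qed.

Let same_law_sample i j : i != j ->
  same_law P (pairRV U U') (pairRV (Us i) (Us j)).
Proof. exact: same_law_sample_pair. Qed.

Let mpair i j : measurable_fun setT (fun w => (Us i w, Us j w)).
Proof. exact: measurable_fun_pair. Qed.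

Let D i j w := kap (Us i w, Us j w) *
  (expR (- (L * (m%:R^-1 * \sum_(k < m) F ((Us i w, Us j w), Ys k w)))) -
   expR (- (L * p (Us i w, Us j w)))).

Let b (z : (T * T) * T2) := F z - p z.1.
Let B i j w := kap (Us i w, Us j w) *
  (m%:R^-1 * \sum_(k < m) b ((Us i w, Us j w), Ys k w)).

Let m_neq0 : m%:R != 0 :> R. Proof. by rewrite pnatr_eq0 -lt0n. Qed.

Let meanF01 i j w : 0 <= m%:R^-1 * \sum_(k < m) F ((Us i w, Us j w), Ys k w).
Proof.
rewrite mulr_ge0// sumr_ge0// => k _.
by case/andP: (F01 ((Us i w, Us j w), Ys k w)).
Qed.

Let D_le_B i j w : D i j w ^+ 2 <= L ^+ 2 * B i j w ^+ 2.
Proof.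
have -> : L ^+ 2 * B i j w ^+ 2 = kap (Us i w, Us j w) ^+ 2 *
    (L * (m%:R^-1 * \sum_(k < m) b ((Us i w, Us j w), Ys k w))) ^+ 2.
  by rewrite /B; ring.
rewrite /D exprMn ler_wpM2l ?sqr_ge0//.
rewrite -[leLHS]real_normK ?num_real// -[leRHS]real_normK ?num_real//.
rewrite ler_pXn2r ?nnegrE//.
have /andP[p0 _] := miss_probability01 (Us i w, Us j w).
apply: le_trans (expRN_lipschitz (mulr_ge0 L0 (@meanF01 i j w)) (mulr_ge0 L0 p0)) _.
rewrite -mulrBr /b /= sumrB [in leRHS]mulrBr sumr_const card_ord.
by rewrite -[p _ *+ m]mulr_natl mulKf.
Qed.

Let mD i j : measurable_fun setT (D i j).
Proof.
apply: measurable_funM; first exact: (measurableT_comp mkap (@mpair i j)).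
apply: measurable_funB.
  apply: measurableT_comp => //; apply: measurableT_comp => //.
  apply: measurable_funM => //; apply: measurable_funM => //.
  apply: measurable_sum => k; apply: (measurableT_comp mF).
  exact: measurable_fun_pair.
apply: measurableT_comp => //; apply: measurableT_comp => //.
apply: measurable_funM => //.
exact: (measurableT_comp measurable_miss_probability (@mpair i j)).
Qed.

Let mb : measurable_fun setT b.
Proof.
apply: measurable_funB => //.
exact: (measurableT_comp measurable_miss_probability measurable_fst).
Qed.

Let b_le1 z : `|b z| <= 1.
Proof.
have /andP[? ?] := F01 z; have /andP[? ?] := miss_probability01 z.1.
by rewrite ler_norml; apply/andP; split; rewrite /b; lra.
Qed.

Let b_mean0 x : \int[P]_w b (x, Y w) = 0.
Proof.
rewrite /b/= RintegralB//; [|exact: LFx|exact: L1_cst].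
by rewrite Rintegral_prob_cst subrr.
Qed.

Let L1kap i j : i != j -> L1 (fun w => kap (Us i w, Us j w) ^+ 2).
Proof.
move=> ij; apply: (same_law_L1 (same_law_sample ij) (f := fun z => kap z ^+ 2)) => //.
exact: measurable_funX.
Qed.

Let L1D2 i j : i != j -> L1 (fun w => D i j w ^+ 2).
Proof.
move=> ij; apply: (L1_dominated _ (L1kap ij)); first exact: measurable_funX.
move=> w; rewrite ger0_norm ?sqr_ge0// /D exprMn ler_piMr ?sqr_ge0//.
have /andP[p0 _] := miss_probability01 (Us i w, Us j w).
have /andP[e0 e1] := expRN01 p0; have /andP[e0' e1'] := expRN01 (@meanF01 i j w).
set u := expR _ in e0' e1' *; set v := expR _ in e0 e1 *.
by rewrite -(real_normK (num_real _)) expr_le1// ler_norml; apply/andP; split; lra.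
Qed.

Let mB i j : measurable_fun setT (B i j).
Proof.
apply: measurable_funM; first exact: (measurableT_comp mkap (@mpair i j)).
apply: measurable_funM => //; apply: measurable_sum => k.
by apply: (measurableT_comp mb); exact: measurable_fun_pair.
Qed.

Let L1B2 i j : i != j -> L1 (fun w => B i j w ^+ 2).
Proof.
move=> ij; apply: (L1_dominated _ (L1kap ij)); first exact: measurable_funX.
move=> w; rewrite ger0_norm ?sqr_ge0// /B exprMn ler_piMr ?sqr_ge0//.
rewrite -(real_normK (num_real _)) expr_le1// normrM normfV normr_nat.
rewrite ler_pdivrMl ?ltr0n// mulr1 (le_trans (ler_norm_sum _ _ _))//.
rewrite (le_trans (ler_sum _ (fun k _ => b_le1 _)))// sumr_const card_ord.
by rewrite lexx.
Qed.

Let intB2 i j : i != j -> \int[P]_w (B i j w ^+ 2) = s3 / m%:R.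
Proof.
move=> ij; have := monte_carlo_second_moment (X := pairRV (Us i) (Us j)) YsY
  (@UsYs i j) (fun k l _ => @UsYs2 i j k l)
  (fun k l => @mutually_independent2 _ _ _ P _ _ _ _ indYs k l)
  mkap mb b_le1 b_mean0 (L1kap ij) m1.
move=> E; apply: (etrans E).
apply: (congr1 (fun x => x / m%:R)); apply: esym.
pose q x := kap x ^+ 2 * \int[P]_w (b (x, Y w) ^+ 2).
apply: (same_law_Rintegral (f := q) (same_law_sample ij)).
apply: measurable_funM; first exact: measurable_funX.
have mb2 : measurable_fun setT (fun z => b z ^+ 2) by exact: measurable_funX.
exact: (measurable_fun_integral_snd P Y mb2).
Qed.

Let hatB w : hat w - ust w =
  c * \sum_(i < n) \sum_(j < n | (i < j)%N) D i j w.
Proof.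
rewrite /hat /ust -mulrBr -sumrB; congr (_ * _); apply: eq_bigr => i _.
by rewrite -sumrB; apply: eq_bigr => j _; rewrite /D /f mulrBr.
Qed.

Let neq_lt (i j : 'I_n) : (i < j)%N -> i != j.
Proof. by move=> ij; rewrite -(inj_eq val_inj)/= ltn_eqF. Qed.

Let L1hatB : L1 (fun w => (hat w - ust w) ^+ 2).
Proof.
under eq_fun do rewrite hatB exprMn.
apply: L1Z; apply: L1_sum_sqr => i _; first exact: measurable_sum_cond.
by apply: L1_sum_sqr => j // ij; apply: L1D2; exact: neq_lt.
Qed.

Let hat_ust : \int[P]_w ((hat w - ust w) ^+ 2) <= L ^+ 2 / m%:R * s3.
Proof.
pose maj w := c * \sum_(i < n) \sum_(j < n | (i < j)%N) (L ^+ 2 * B i j w ^+ 2).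
have Lmaj : L1 maj.
  apply: L1Z; do 2 (apply: L1_sum => ? ?); apply: L1Z; apply: L1B2.
  exact: neq_lt.
have : \int[P]_w ((hat w - ust w) ^+ 2) <= \int[P]_w maj w.
  apply: le_Rintegral => // w _; rewrite hatB.
  apply: le_trans (mean_sqr _) _; rewrite ler_pM2l//.
  by do 2 (apply: ler_sum => ? _); exact: D_le_B.
move=> /le_trans; apply; rewrite /maj RintegralZl//; last first.
  by do 2 (apply: L1_sum => ? ?); apply: L1Z; apply: L1B2; exact: neq_lt.
rewrite Rintegral_sum; last first.
  by move=> i _; apply: L1_sum => ? ?; apply: L1Z; apply: L1B2; exact: neq_lt.
rewrite (eq_bigr (fun i : 'I_n => (L ^+ 2 / m%:R * s3) *
    \sum_(j < n | (i < j)%N) 1)); last first.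
  move=> i _; rewrite Rintegral_sum; last first.
    by move=> ? ?; apply: L1Z; apply: L1B2; exact: neq_lt.
  rewrite mulr_sumr; apply: eq_bigr => j ij.
  rewrite RintegralZl//; last by apply: L1B2; exact: neq_lt.
  by rewrite intB2 ?neq_lt// mulr1 mulrA mulrAC.
by rewrite -mulr_sumr sum1 mulrCA divff ?mulr1// gt_eqF.
Qed.

Let a x := f x - th.

Let ma : measurable_fun setT a.
Proof. by apply: measurable_funB => //; exact: measurable_weighted_kernel. Qed.

Let sf x y : f (x, y) = f (y, x).
Proof.
rewrite /f skap; congr (_ * expR (- (_ * _))); apply: eq_Rintegral => w _.
by rewrite sF.
Qed.

Let L1f : L1 (fun w => f (U w, U' w)).
Proof.
apply: L1_of_sqr => //; apply: (measurableT_comp measurable_weighted_kernel).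
exact: measurable_fun_pair.
Qed.

Let L1fx x : L1 (fun w => f (x, U w)).
Proof. by apply: L1_of_sqr; [exact: (measurableT_comp (@mfx x))|exact: L1f2x]. Qed.

Let L1a2 : L1 (fun w => a (U w, U' w) ^+ 2).
Proof.
apply: L1D_sqr => //; last exact: L1_cst.
by apply: (measurableT_comp measurable_weighted_kernel); exact: measurable_fun_pair.
Qed.

Let L1a2x x : L1 (fun w => a (x, U w) ^+ 2).
Proof.
apply: L1D_sqr => //; last exact: L1_cst.
exact: (measurableT_comp (@mfx x)).
Qed.

Let a_mean0 : \int[P]_w a (U w, U' w) = 0.
Proof.
rewrite RintegralB//; last exact: L1_cst.
by rewrite Rintegral_prob_cst subrr.
Qed.

Let ustB w : ust w - th = c * \sum_(i < n) \sum_(j < n | (i < j)%N) a (Us i w, Us j w).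
Proof.
have -> : th = c * \sum_(i < n) \sum_(j < n | (i < j)%N) th.
  rewrite -[th in RHS]mulr1; under eq_bigr do rewrite -mulr_sumr.
  by rewrite -mulr_sumr sum1 mulrCA divff ?mulr1// gt_eqF.
rewrite /ust -mulrBr -sumrB; congr (_ * _); apply: eq_bigr => i _.
rewrite -sumrB; apply: eq_bigr => j _; rewrite /a /th.
by [].
Qed.

Let L1ustB : L1 (fun w => (ust w - th) ^+ 2).
Proof.
under eq_fun do rewrite ustB exprMn.
have mas i j : measurable_fun setT (fun w => a (Us i w, Us j w)).
  exact: (measurableT_comp ma (@mpair i j)).
apply: L1Z; apply: L1_sum_sqr => i _; first exact: measurable_sum_cond.
apply: L1_sum_sqr => [j _|j ij]; first exact: mas.
exact: (L1_sample_sqr UU' U'U UsU indUs ma L1a2 (neq_lt ij)).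
Qed.

Let ust_th : \int[P]_w ((ust w - th) ^+ 2) =
  2 / (n%:R * (n%:R - 1)) * s1 + 4 * (n%:R - 2) / (n%:R * (n%:R - 1)) * s2.
Proof.
under eq_Rintegral do rewrite ustB.
rewrite (@u_statistic_second_moment _ _ _ P _ _ U U')//; last first.
  by move=> x y; rewrite /a sf.
rewrite (_ : \int[P]_w (\int[P]_w' a (U w, U w')) ^+ 2 = s2).
  have n0 : n%:R != 0 :> R by rewrite gt_eqF// (lt_trans ltr01).
  have n10 : n%:R - 1 != 0 :> R by rewrite gt_eqF// subr_gt0.
  by rewrite -/s1 /c; field; rewrite n0 n10.
apply: eq_Rintegral => w _; rewrite RintegralB//; [|exact: L1fx|exact: L1_cst].
by rewrite Rintegral_prob_cst.
Qed.

(** Integrability is part of the conclusion: an infinite mean square error would have [Rintegral]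
    equal to 0, and the inequality would carry no information. *)
Lemma nested_estimator_mse :
  L1 (fun w => (hat w - th) ^+ 2) /\
  \int[P]_w ((hat w - th) ^+ 2) <=
  2 * (2 / (n%:R * (n%:R - 1)) * s1 +
       4 * (n%:R - 2) / (n%:R * (n%:R - 1)) * s2 + L ^+ 2 / m%:R * s3).
Proof.
have mhatB : measurable_fun setT (fun w => hat w - ust w).
  by under eq_fun do rewrite hatB; apply: measurable_funM => //;
    apply: measurable_sum => i; exact: measurable_sum_cond.
have mustB : measurable_fun setT (fun w => ust w - th).
  under eq_fun do rewrite ustB; apply: measurable_funM => //.
  apply: measurable_sum => i; apply: measurable_sum_cond => j _.
  exact: (measurableT_comp ma (@mpair i j)).
have split w : hat w - th = (hat w - ust w) + (ust w - th) by ring.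
have L1h : L1 (fun w => (hat w - th) ^+ 2).
  by under eq_fun do rewrite split; exact: L1D_sqr.
split => //.
have L1m : L1 (fun w => 2 * ((hat w - ust w) ^+ 2 + (ust w - th) ^+ 2)).
  by apply: L1Z; exact: L1D.
apply: (@le_trans _ _ (\int[P]_w (2 * ((hat w - ust w) ^+ 2 + (ust w - th) ^+ 2)))).
  apply: le_Rintegral => // w _; rewrite split.
  set u := hat w - ust w; set v := ust w - th.
  have -> : 2 * (u ^+ 2 + v ^+ 2) = (u + v) ^+ 2 + (u - v) ^+ 2 by ring.
  by rewrite lerDl sqr_ge0.
rewrite RintegralZl//; last exact: L1D.
rewrite RintegralD// ler_pM2l// addrC -ust_th lerD2l.
exact: hat_ust.
Qed.

Let mfUU : measurable_fun setT (fun w => f (U w, U' w)).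
Proof.
by apply: (measurableT_comp measurable_weighted_kernel); exact: measurable_fun_pair.
Qed.

Let L1_shift (Z : Omega -> R) : L1 Z -> L1 (fun w => Z w ^+ 2) ->
  L1 (fun w => (Z w - th) ^+ 2).
Proof.
move=> IZ IZ2; apply: L1D_sqr => //; last exact: L1_cst.
exact: L1_measurable IZ.
Qed.

Let variance_weighted : 'V_P[fun w => f (U w, U' w)]%E = s1%:E.
Proof. by apply: variance_Rintegral => //; exact: L1_shift. Qed.

Section projection.
Context d3 {T3 : measurableType d3} (v : {mfun T >-> T3}) (G : T3 -> R).
Hypotheses (mG : measurable_fun setT G)
  (GE : forall u, G (v u) = \int[P]_w f (u, U w)).

Let Lfx' u : L1 (fun w => f (u, U' w)).
Proof.
apply: (same_law_L1 (X := U) (f := fun y => f (u, y))) => //; last exact: L1fx.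
by move=> B' mB'; rewrite U'U.
Qed.

Let Lf2x' u : L1 (fun w => f (u, U' w) ^+ 2).
Proof.
apply: (same_law_L1 (X := U) (f := fun y => f (u, y) ^+ 2)); last exact: L1f2x.
  by move=> B' mB'; rewrite U'U.
exact: measurable_funX.
Qed.

Let gE u : g u = \int[P]_w f (u, U' w).
Proof. by apply/esym; exact: (same_law_Rintegral U'U (@mfx u)). Qed.

Let mg : measurable_fun setT g.
Proof. exact: (measurable_fun_integral_snd P U measurable_weighted_kernel). Qed.

Let L1g : L1 (fun w => g (U w)).
Proof.
have [I _] := independent_Rintegral UU' measurable_weighted_kernel L1f Lfx'.
have -> : (fun w => (g (U w))%:E) = (fun w => (\int[P]_w' f (U w, U' w'))%:E).
  by apply/funext => w; exact: (congr1 EFin (gE (U w))).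
exact: I.
Qed.

Let L1g2 : L1 (fun w => g (U w) ^+ 2).
Proof.
have mf2 : measurable_fun setT (fun z => f z ^+ 2).
  by apply: measurable_funX; exact: measurable_weighted_kernel.
have [I2 _] := independent_Rintegral UU' mf2 L1f2 Lf2x'.
apply: (L1_dominated _ I2) => [|w].
  by apply: measurable_funX; exact: (measurableT_comp mg).
by rewrite ger0_norm ?sqr_ge0// gE Rintegral_sqr_le.
Qed.

(** The mean of [f (u, .)] depends on [u] only through [v u], by [GE]. Conditioning on [v \o U] thus
    yields [g \o U] almost surely, and the variance does not see null sets. *)
Lemma variance_projection :
  'V_P[cond_exp P (fun w => f (U w, U' w)) (v \o U)]%E = s2%:E.
Proof.
have ce : is_cond_exp P (fun w => f (U w, U' w)) (v \o U) (G \o (v \o U)).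
  have GE' u : G (v u) = \int[P]_w f (u, U' w) by rewrite -[RHS]gE; exact: GE.
  exact: (is_cond_exp_independent UU' measurable_weighted_kernel L1f Lfx' mG GE').
have [_ Ic _] := cond_exp_is (V := v \o U : {mfun Omega >-> T3}) ce.
rewrite -(variance_Rintegral (X := g \o U) L1g); last 2 first.
- apply/esym.
  have [_ E] := independent_Rintegral UU' measurable_weighted_kernel L1f Lfx'.
  by apply: (etrans E); apply: eq_Rintegral => w _; exact/esym/gE.
- exact: (L1_shift L1g L1g2).
apply: (eq_variance_ae Ic L1g).
apply: filterS (cond_exp_ae (V := v \o U : {mfun Omega >-> T3}) ce) => w -> /=.
exact: GE.
Qed.

End projection.

Section conditional_variance.
Hypothesis UY : independent P Y (pairRV U U').
Context d3 {T3 : measurableType d3} (v : {mfun (T * T)%type >-> T3}) (k : T3 -> R).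
Hypotheses (mk : measurable_fun setT k) (k0 : forall t, 0 <= k t)
  (kE : forall z, k (v z) = kap z ^+ 2).

(** The weight [kap ^+ 2] is a function of the conditioning variable, by [kE], so it can be carried
    through the comparison of conditional variances. *)
Lemma le_conditional_variance :
  (s3%:E <= 'E_P[fun w => (kap (U w, U' w) ^+ 2 *
    cond_var P (fun w => F ((U w, U' w), Y w)) (v \o pairRV U U') w)%R])%E.
Proof.
have := le_cond_var_integral (independentC UY) v mF F01 mk k0.
have mb2 : measurable_fun setT (fun z => b z ^+ 2) by exact: measurable_funX.
have Is3 : L1 (fun w => kap (U w, U' w) ^+ 2 *
    \int[P]_w' (b ((U w, U' w), Y w') ^+ 2)).
  apply: (L1_dominated _ kap2) => [|w].
    apply: measurable_funM.
      apply: measurable_funX; apply: (measurableT_comp mkap).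
      exact: measurable_fun_pair.
    apply: (measurableT_comp (measurable_fun_integral_snd P Y mb2)).
    exact: measurable_fun_pair.
  have /andP[q0 q1] : 0 <= \int[P]_w' (b ((U w, U' w), Y w') ^+ 2) <= 1.
    apply: Rintegral01 => [|w'].
      by apply: (measurableT_comp mb2); exact: measurable_fun_pair.
    by rewrite sqr_ge0/= -(real_normK (num_real _)) expr_le1.
  rewrite ger0_norm; last exact: (mulr_ge0 (sqr_ge0 _) q0).
  exact: (ler_piMr (sqr_ge0 _) q1).
rewrite unlock (EFin_Rintegral Is3) => h.
apply: le_trans (le_trans h _); rewrite le_eqVlt; apply/orP; left; apply/eqP;
  by apply: eq_integral => w _; rewrite kE.
Qed.

End conditional_variance.

Lemma nested_estimator_bound
    d3 (T3 : measurableType d3) (v : {mfun T >-> T3}) (G : T3 -> R)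
    d4 (T4 : measurableType d4) (v' : {mfun (T * T)%type >-> T4}) (k : T4 -> R) :
  independent P Y (pairRV U U') ->
  measurable_fun setT G -> (forall u, G (v u) = \int[P]_w f (u, U w)) ->
  measurable_fun setT k -> (forall t, 0 <= k t) ->
  (forall z, k (v' z) = kap z ^+ 2) ->
  ('E_P[fun w => ((hat w - th) ^+ 2)%R] <=
   2%:E * ((2 / (n%:R * (n%:R - 1)))%:E * 'V_P[fun w => f (U w, U' w)] +
     (4 * (n%:R - 2) / (n%:R * (n%:R - 1)))%:E *
       'V_P[cond_exp P (fun w => f (U w, U' w)) (v \o U)] +
     (L ^+ 2 / m%:R)%:E * 'E_P[fun w => (kap (U w, U' w) ^+ 2 *
       cond_var P (fun w => F ((U w, U' w), Y w)) (v' \o pairRV U U') w)%R]))%E.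
Proof.
move=> UY mG GE mk k0 kE; have [Ih mse] := nested_estimator_mse.
rewrite expectation_Rintegral// variance_weighted (variance_projection mG GE).
apply: (@le_trans _ _ (2 * (2 / (n%:R * (n%:R - 1)) * s1 +
  4 * (n%:R - 2) / (n%:R * (n%:R - 1)) * s2 + L ^+ 2 / m%:R * s3))%:E).
  by rewrite lee_fin.
rewrite EFinM lee_wpmul2l ?lee_fin// !EFinD !EFinM leeD2l//.
rewrite lee_wpmul2l//; last exact: (le_conditional_variance UY mk k0 kE).
by rewrite lee_fin divr_ge0 ?sqr_ge0.
Qed.

End nested_estimator.

(** * HSIC for an ANOVA kernel *)

Section hsic_of_anova_kernel.
Context {R : realType} d {Omega : measurableType d} (P : probability Omega R).
Context d0 d1 d2 {T0 : measurableType d0} {T1 : measurableType d1}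
  {T2 : measurableType d2}.
Local Notation L1 f := (P.-integrable setT (fun w => (f w)%:E)).
Variables (x : {mfun T0 >-> T1}) (y : {mfun T0 >-> T2}).
Variables (U U' : {mfun Omega >-> T0}).
Hypotheses (UU' : independent P U U') (U'U : same_law P U' U).
Variables (k1 : T1 -> T1 -> R) (k2 : T2 -> T2 -> R) (H : rkhs (tensor k1 k2)).
Hypotheses (mk1 : forall a, measurable_fun setT (k1 a))
  (mk2 : forall g, measurable_fun setT (k2 g)).
(* Joint measurability is only available after pulling [k2] back along [y].   *)
Hypotheses
  (mk1x : measurable_fun setT (fun z : T0 * T0 => k1 (x z.1) (x z.2)))
  (mk2y : measurable_fun setT (fun z : T0 * T0 => k2 (y z.1) (y z.2))).
Hypothesis sk1 : forall a b, k1 a b = k1 b a.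
Hypotheses (k1_sqr : forall a b, k1 a b ^+ 2 <= k1 a a * k1 b b)
  (k1_ge0 : forall a, 0 <= k1 a a) (k2_01 : forall a b, 0 <= k2 a b <= 1).
Hypotheses (k1_int : L1 (fun w => k1 (x (U w)) (x (U w))))
  (k1_mean : forall a, \int[P]_w k1 a (x (U w)) = 1).

Let q u := k1 (x u) (x u).

Let mxU : measurable_fun setT (x \o U). Proof. exact: measurableT_comp. Qed.
Let mq : measurable_fun setT q.
Proof.
apply: (measurableT_comp mk1x (g := fun u => (u, u))).
exact: measurable_fun_pair.
Qed.

Let qU' : L1 (fun w => q (U' w)).
Proof. by apply: (same_law_L1 (X := U) (f := q)) => // B mB; rewrite U'U. Qed.

Let k1_le a b : `|k1 a b| <= k1 a a + k1 b b.
Proof.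
have ab := addr_ge0 (k1_ge0 a) (k1_ge0 b).
rewrite -(@ler_pXn2r _ 2%N)// ?nnegrE// real_normK ?num_real//.
apply: le_trans (k1_sqr a b) _.
by have := k1_ge0 a; have := k1_ge0 b; nra.
Qed.

Let Dker z (u : T0) := (k1 z.1 (x u) - 1) * k2 z.2 (y u).

Let Dker_le z u : `|Dker z u| <= k1 z.1 z.1 + 1 + q u.
Proof.
rewrite /Dker normrM; have /andP[? ?] := k2_01 z.2 (y u).
rewrite [X in _ * X]ger0_norm//.
have h : `|k1 z.1 (x u) - 1| <= k1 z.1 z.1 + 1 + q u.
  rewrite (le_trans (ler_normB _ _))// normr1.
  by have := k1_le z.1 (x u); rewrite /q; lra.
apply: le_trans h; exact: ler_piMr.
Qed.

Let mDker z : measurable_fun setT (Dker z).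
Proof.
apply: measurable_funM; first apply: measurable_funB => //.
  exact: (measurableT_comp (mk1 z.1)).
exact: (measurableT_comp (mk2 z.2)).
Qed.

Let L1Dker z : L1 (fun w => Dker z (U w)).
Proof.
apply: (L1_dominated _ (L1D (L1_cst P (k1 z.1 z.1 + 1)) k1_int)).
  exact: (measurableT_comp (mDker z)).
by move=> w; exact: Dker_le.
Qed.

Definition embedding_gap z := \int[P]_w Dker z (U w).
Local Notation D := embedding_gap.

(** The independent copy realises the product of the marginals as the law of (x(U), y(U')). *)
Let l (f : T1 * T2 -> R) :=
  \int[P]_w f (x (U w), y (U w)) - \int[P]_w f (x (U w), y (U' w)).

Let V : set (T1 * T2 -> R) := [set f | rkhs_fun H f /\ measurable_fun setT f].

(** Arithmetic-geometric mean inequality on the square root of N [k1 z.1 z.1]. The weight 1/4 on N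
    is chosen for [l_bnd]: 2 [l f] is twice a difference of two such terms, so the total weight of N
    is 1. *)
Let f_le f z : rkhs_fun H f ->
  `|f z| <= (rkhs_dot H f f + 4 * k1 z.1 z.1) / 4.
Proof.
move=> Ff; have N0 := rkhs_dot_ge0 Ff; set N := rkhs_dot H f f in N0 *.
rewrite ler_pdivlMr// -(@ler_pXn2r _ 2%N)// ?nnegrE; last 2 first.
- by rewrite mulr_ge0.
- by rewrite addr_ge0// mulr_ge0.
rewrite exprMn real_normK ?num_real//.
have := rkhs_eval_sqr z Ff; rewrite /tensor -/N.
have /andP[? ?] := k2_01 z.2 z.2; have := k1_ge0 z.1.
set a := k1 _ _; set b := k2 _ _ => a0 fz.
have : a * b * N <= a * N by rewrite mulrAC ler_piMr// mulr_ge0.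
by have := sqr_ge0 (N - 4 * a); nra.
Qed.

Let mpair1 : measurable_fun setT (fun w => (x (U w), y (U w))).
Proof. by apply: measurable_fun_pair; exact: measurableT_comp. Qed.
Let mpair2 : measurable_fun setT (fun w => (x (U w), y (U' w))).
Proof. by apply: measurable_fun_pair; exact: measurableT_comp. Qed.

Let L1V f : V f -> L1 (fun w => f (x (U w), y (U w))) /\
  L1 (fun w => f (x (U w), y (U' w))).
Proof.
move=> [Ff mf]; have B := L1D (L1_cst P (rkhs_dot H f f / 4)) k1_int.
have bnd z : `|f z| <= rkhs_dot H f f / 4 + k1 z.1 z.1.
  by have := f_le z Ff; lra.
split; apply: (L1_dominated _ B); [exact: measurableT_comp|by []| |by []].
exact: measurableT_comp.
Qed.

Let kz_meas z : measurable_fun setT (tensor k1 k2 z).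
Proof. by apply: measurable_funM; apply: measurableT_comp. Qed.

Let VK z : V (tensor k1 k2 z).
Proof. by split => //; exact: rkhs_kernel. Qed.

(** Under the product law the expectation factorises, and the factor coming from [k1] is 1; the - 1
    in [Dker] is what remains of it. *)
Let lkD z : l (tensor k1 k2 z) = D z.
Proof.
rewrite /l; have [I1 I2] := L1V (VK z).
have mk1z : measurable_fun setT (k1 z.1 \o x) by exact: measurableT_comp.
have mk2z : measurable_fun setT (k2 z.2 \o y) by exact: measurableT_comp.
have Ik1 : L1 (fun w => k1 z.1 (x (U w))).
  apply: (L1_dominated _ (L1D (L1_cst P (k1 z.1 z.1)) k1_int)).
    exact: (measurableT_comp mk1z).
  by move=> w; exact: k1_le.
have Ik2 (Z : {mfun Omega >-> T0}) : L1 (fun w => k2 z.2 (y (Z w))).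
  apply: (L1_dominated _ (L1_cst P 1)); first exact: (measurableT_comp mk2z).
  by move=> w; have /andP[? ?] := k2_01 z.2 (y (Z w)); rewrite ger0_norm.
have [_ E] := independent_RintegralM UU' mk1z mk2z Ik1 (Ik2 U').
have {}E : \int[P]_w tensor k1 k2 z (x (U w), y (U' w)) =
    \int[P]_w k2 z.2 (y (U w)).
  apply: (etrans E); rewrite /= k1_mean mul1r.
  exact: (same_law_Rintegral (f := k2 z.2 \o y)).
rewrite E -RintegralB//; last exact: (Ik2 U).
by apply: eq_Rintegral => w _; rewrite /tensor /Dker /= mulrBl mul1r.
Qed.

Let joint_embedding z :
  mean_embedding (tensor k1 k2) (distribution P (pairRV (x \o U) (y \o U))) z =
  \int[P]_w tensor k1 k2 z (x (U w), y (U w)).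
Proof.
rewrite /mean_embedding /Rintegral; congr fine.
under eq_integral do rewrite (rkhs_kernel_sym H).
rewrite (integral_distribution_comp P (pairRV (x \o U) (y \o U))
  (f := EFin \o tensor k1 k2 z))//.
exact/measurable_EFinP.
Qed.

Let product_embedding z :
  mean_embedding (tensor k1 k2)
    (distribution P (x \o U) \x distribution P (y \o U))%E z =
  \int[P]_w tensor k1 k2 z (x (U w), y (U' w)).
Proof.
rewrite /mean_embedding /Rintegral; congr fine.
under eq_integral do rewrite (rkhs_kernel_sym H).
rewrite (eq_measure_integral (distribution P (pairRV (x \o U) (y \o U')))).
  rewrite (integral_distribution_comp P (pairRV (x \o U) (y \o U'))
    (f := EFin \o tensor k1 k2 z))//.
  exact/measurable_EFinP.
move=> C mC _; apply: product_measure_unique => // A B mA mB.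
have mxA : measurable (x @^-1` A).
  by rewrite -[X in measurable X]setTI; exact: measurable_funP.
have myB : measurable (y @^-1` B).
  by rewrite -[X in measurable X]setTI; exact: measurable_funP.
have := UU' mxA myB; rewrite (U'U myB); exact.
Qed.

Let L1DU2 (Z : {mfun Omega >-> T0}) : same_law P Z U -> independent P U Z ->
  L1 (fun w => Dker (x (U w), y (U w)) (Z w)).
Proof.
move=> ZU _.
have LZ : L1 (fun w => q (Z w)).
  by apply: (same_law_L1 (X := U) (f := q)) => // B mB; rewrite ZU.
apply: (L1_dominated _ (L1D (L1D k1_int (L1_cst P 1)) LZ)).
  apply: measurable_funM; first apply: measurable_funB => //.
    apply: (measurableT_comp mk1x (g := fun w => (U w, Z w))).
    exact: measurable_fun_pair.
  apply: (measurableT_comp mk2y (g := fun w => (U w, Z w))).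
  exact: measurable_fun_pair.
by move=> w; exact: Dker_le.
Qed.

(** By symmetry [k1] also has mean 1 in its first argument, so the gap is centred there. This
    cancels the product-law term of [l D]. *)
Let D_cross v : \int[P]_w D (x (U w), v) = 0.
Proof.
pose F (z : T0 * T0) := Dker (x z.1, v) z.2.
have mF : measurable_fun setT F.
  apply: measurable_funM; first exact: measurable_funB.
  by apply: (measurableT_comp (mk2 v)); exact: measurableT_comp.
have LF : L1 (fun w => F (U w, U' w)).
  apply: (L1_dominated _ (L1D (L1D k1_int (L1_cst P 1)) qU')).
    by apply: (measurableT_comp mF); exact: measurable_fun_pair.
  by move=> w; exact: Dker_le.
have LFx u : L1 (fun w => F (u, U' w)).
  apply: (L1_dominated _ (L1D (L1_cst P (k1 (x u) (x u) + 1)) qU')).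
    by apply: (measurableT_comp mF); exact: measurable_fun_pair.
  by move=> w; exact: Dker_le.
have [_ E] := independent_Rintegral UU' mF LF LFx.
transitivity (\int[P]_w F (U w, U' w)).
  rewrite E; apply: eq_Rintegral => w _; apply/esym.
  exact: (same_law_Rintegral (f := Dker (x (U w), v)) U'U).
(* With the coordinates exchanged, Fubini freezes [U'] and integrates over [U], the argument in
   which the centring is now used. *)
pose G (z : T0 * T0) := F (z.2, z.1).
have mG : measurable_fun setT G.
  by apply: (measurableT_comp mF (g := fun z => (z.2, z.1))); exact: measurable_fun_pair.
have LGx u : L1 (fun w => G (u, U w)).
  apply: (L1_dominated _ (L1D (L1D k1_int (L1_cst P 1)) (L1_cst P (q u)))).
    by apply: (measurableT_comp mG); exact: measurable_fun_pair.
  by move=> w; exact: Dker_le.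
have [_ E'] := independent_Rintegral (independentC UU') mG LF LGx.
apply: (etrans E'); rewrite -[RHS](Rintegral_prob_cst P 0).
apply: eq_Rintegral => w _; rewrite /G/F/Dker/=.
have Ik1 : L1 (fun w' => k1 (x (U w')) (x (U' w))).
  under eq_fun do rewrite sk1.
  apply: (L1_dominated _ (L1D (L1_cst P (q (U' w))) k1_int)).
    exact: (measurableT_comp (mk1 (x (U' w)))).
  by move=> w'; exact: k1_le.
rewrite RintegralZr//; last by apply: L1B => //; exact: L1_cst.
rewrite RintegralB//; last exact: L1_cst.
rewrite Rintegral_prob_cst; under eq_Rintegral do rewrite sk1.
by rewrite k1_mean subrr mul0r.
Qed.

(** The squared norm of the representer [D] is [l D]. Its product-law term vanishes by [D_cross],
    and its joint-law term unfolds into a double expectation. *)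
Lemma hsic_anova :
  measurable_fun setT D /\
  HSIC P H (x \o U) (y \o U) =
  \int[P]_w ((k1 (x (U w)) (x (U' w)) - 1) * k2 (y (U w)) (y (U' w))).
Proof.
have Vlim (u : nat -> T1 * T2 -> R) f : (forall n, V (u n)) -> rkhs_fun H f ->
    (forall z, u n z @[n --> \oo] --> f z) -> V f.
  move=> Vu Ff uf; split => //.
  apply: (measurable_fun_cvg (h := u)) => [n|z _]; last exact: uf.
  by case: (Vu n).
have V0 : V (fun=> 0) by split; [exact: rkhs_fun0|exact: measurable_cst].
have VL a f g : V f -> V g -> V (fun z => a * f z + g z).
  move=> [Ff mf] [Fg mg]; split; first exact: rkhs_funL.
  by apply: measurable_funD => //; exact: measurable_funM.
have lL a f g : V f -> V g -> l (fun z => a * f z + g z) = a * l f + l g.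
  move=> Vf Vg; have [f1 f2] := L1V Vf; have [g1 g2] := L1V Vg.
  rewrite /l !RintegralD//; try exact: L1Z.
  by rewrite !RintegralZl//; ring.
have l_bnd f : V f -> 2 * l f <= rkhs_dot H f f + 4 * \int[P]_w q (U w).
  move=> Vf; have [f1 f2] := L1V Vf; have [Ff _] := Vf.
  rewrite /l -RintegralB// -RintegralZl//; last exact: L1B.
  rewrite -(Rintegral_prob_cst P (rkhs_dot H f f)) -RintegralZl//.
  rewrite -RintegralD//; [|exact: L1_cst|exact: L1Z].
  apply: le_Rintegral => //; [exact/L1Z/L1B|by apply: L1D; [exact: L1_cst|exact: L1Z]|].
  move=> w _; have := f_le (x (U w), y (U w)) Ff.
  have := f_le (x (U w), y (U' w)) Ff; rewrite /= !ler_norml -/(q (U w)).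
  by move=> /andP[? ?] /andP[? ?]; lra.
have [VD HD] := rkhs_representer (fun f (Vf : V f) => Vf.1) V0 VK VL Vlim lL l_bnd.
have DE : (fun z => l (tensor k1 k2 z)) = D by apply/funext => z; exact: lkD.
rewrite DE in VD HD; have [_ mD] := VD; split => //.
rewrite /HSIC (_ : _ \- _ = D); last first.
  by apply/funext => z; rewrite /= joint_embedding product_embedding -lkD.
rewrite HD /l.
have [ID1 ID2] := L1V VD.
have -> : \int[P]_w D (x (U w), y (U' w)) = 0.
  pose F (z : T0 * T0) := D (x z.2, y z.1).
  have mF : measurable_fun setT F.
    apply: (measurableT_comp mD (g := fun z => (x z.2, y z.1))).
    by apply: measurable_fun_pair; exact: measurableT_comp.
  have LFx u : L1 (fun w => F (u, U w)).
    apply: (L1_dominated _ (L1D (L1_cst P (rkhs_dot H D D / 4)) k1_int)).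
      by apply: (measurableT_comp mF); exact: measurable_fun_pair.
    by move=> w; have := f_le (x (U w), y u) VD.1; rewrite /F/=; lra.
  have [_ E] := independent_Rintegral (independentC UU') mF ID2 LFx.
  apply: (etrans E); rewrite -[RHS](Rintegral_prob_cst P 0).
  by apply: eq_Rintegral => w _; exact: (D_cross (y (U' w))).
rewrite subr0.
pose F (z : T0 * T0) := Dker (x z.1, y z.1) z.2.
have mF : measurable_fun setT F.
  by apply: measurable_funM => //; exact: measurable_funB.
have LFx u : L1 (fun w => F (u, U' w)).
  apply: (L1_dominated _ (L1D (L1_cst P (k1 (x u) (x u) + 1)) qU')).
    by apply: (measurableT_comp mF); exact: measurable_fun_pair.
  by move=> w; exact: Dker_le.
have [_ E] := independent_Rintegral UU' mF (L1DU2 U'U UU') LFx.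
apply/esym; apply: (etrans E); apply: eq_Rintegral => w _.
exact: (same_law_Rintegral (f := Dker (x (U w), y (U w)))).
Qed.

End hsic_of_anova_kernel.

(** * The kernel on random sets *)

Section symmetric_difference_metric.
Context {R : realType} {d : nat} (X : set 'rV[R]_d.+1).
Hypothesis Xfin : (leb X < +oo)%E.
Implicit Types (A B : Lset X) (g : Lstar X).

Lemma Lset_sub A : val A `<=` X.
Proof. by have := valP A; rewrite inE => -[]. Qed.

Lemma leb_symdiff_fin A B : leb (val A `+` val B) \is a fin_num.
Proof.
rewrite ge0_fin_numE ?leb_ge0//; apply: le_lt_trans Xfin; apply: le_leb => z.
by move=> [[+ _]|[+ _]]; exact: Lset_sub.
Qed.

Lemma leb_symdiff_triangle (A B C : set 'rV[R]_d.+1) :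
  (leb (A `+` C) <= leb (A `+` B) + leb (B `+` C))%E.
Proof.
apply: le_trans (outer_measureU2 _ _ _); apply: le_leb => z /=.
by have [Bz|Bz] := pselect (B z); tauto.
Qed.

Lemma Lclass_repr A : leb (val (repr (Lclass A)) `+` val A) = 0%E.
Proof.
apply/eqP.
have : (\pi_(Lstar_quot X) (repr (Lclass A)) = \pi_(Lstar_quot X) A)%qT.
  exact: reprK.
by move/eqmodP.
Qed.

(** Each chosen representative differs from the given set by a null set, which costs nothing in the
    triangle inequality, in either direction. *)
Lemma delta_Lclass A B : delta (Lclass A) (Lclass B) = fine (leb (val A `+` val B)).
Proof.
congr fine; apply/eqP; rewrite eq_le; apply/andP; split.
  apply: (le_trans (leb_symdiff_triangle _ (val A) _)).
  rewrite Lclass_repr add0e (le_trans (leb_symdiff_triangle _ (val B) _))//.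
  by rewrite [X in (_ + leb X)%E]setYC Lclass_repr adde0.
apply: (le_trans (leb_symdiff_triangle _ (val (repr (Lclass A))) _)).
rewrite [X in (leb X + _)%E]setYC Lclass_repr add0e.
apply: (le_trans (leb_symdiff_triangle _ (val (repr (Lclass B))) _)).
by rewrite Lclass_repr adde0.
Qed.

Lemma delta_ge0 g1 g2 : 0 <= delta g1 g2.
Proof. by rewrite fine_ge0// leb_ge0. Qed.

Lemma delta_triangle g1 g2 g3 : delta g1 g3 <= delta g1 g2 + delta g2 g3.
Proof.
rewrite /delta -fineD ?leb_symdiff_fin//.
by rewrite fine_le ?fin_numD ?leb_symdiff_fin//; exact: leb_symdiff_triangle.
Qed.

(** The preimage of an open lower half-line is [delta]-open: around [g1] the ball of radius
    [r - delta g g1] stays inside, by the triangle inequality. *)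
Lemma measurable_delta g : measurable_fun setT (delta g : Lstar X -> R).
Proof.
apply: (measurability _ (RGenInftyO.measurableE R)) => //.
move=> _ [_ [r ->] <-]; rewrite setTI; apply: sub_sigma_algebra => g1 /=.
rewrite in_itv/= => g1r; exists (r - delta g g1); first by rewrite subr_gt0.
move=> g2 g12; rewrite /= in_itv/= (le_lt_trans (delta_triangle g g1 g2))//.
by rewrite -ltrBrDl.
Qed.

Variable sigma : R.

Lemma kset01 g1 g2 : 0 <= kset sigma g1 g2 <= 1.
Proof.
rewrite expR_ge0/= expR_le1 oppr_le0 divr_ge0 ?delta_ge0//.
by rewrite mulr_ge0// sqr_ge0.
Qed.

Lemma measurable_kset g : measurable_fun setT (kset sigma g).
Proof.
apply: measurableT_comp => //; apply: measurableT_comp => //.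
by apply: measurable_funM => //; exact: measurable_delta.
Qed.

End symmetric_difference_metric.

(** * Symmetric differences through a uniform point *)

Section uniform_law.
Context {R : realType} {d : nat} (X : set 'rV[R]_d.+1).
Context dO {Omega : measurableType dO} (P : probability Omega R).
Context dT {T : measurableType dT}.
Variable Y : {mfun Omega >-> borel_rV R d}.
Hypothesis Y_unif : uniform_on P X Y.

(* If [leb X] were infinite or null, [Y] would give mass [0] to the space.    *)
Lemma uniform_on_fin : (leb X < +oo)%E /\ fine (leb X) != 0.
Proof.
have := Y_unif (measurableT : measurable (setT : set (borel_rV R d))).
rewrite preimage_setT probability_setT setTI => -[e1].
have h : fine (leb X) != 0.
  by apply/eqP => e0; move: e1; rewrite e0 mul0r => /eqP; rewrite oner_eq0.
split => //; rewrite ltNge leye_eq; apply/eqP => e.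
by move: h; rewrite e eqxx.
Qed.

Variable G : set (borel_rV R d * T).
Hypothesis mG : measurable G.

Definition symdiff_indicator (z : (T * T) * borel_rV R d) : R :=
  \1_(ysection G z.1.1 `+` ysection G z.1.2 : set (borel_rV R d)) z.2.

Lemma measurable_symdiff_indicator : measurable_fun setT symdiff_indicator.
Proof.
pose S : set ((T * T) * borel_rV R d) :=
  ((fun z => (z.2, z.1.1)) @^-1` G) `+` ((fun z => (z.2, z.1.2)) @^-1` G).
have mS : measurable S.
  have m1 : measurable_fun setT (fun z : (T * T) * borel_rV R d => (z.2, z.1.1)).
    apply: measurable_fun_pair => //.
    exact: (measurableT_comp measurable_fst measurable_fst).
  have m2 : measurable_fun setT (fun z : (T * T) * borel_rV R d => (z.2, z.1.2)).
    apply: measurable_fun_pair => //.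
    exact: (measurableT_comp measurable_snd measurable_fst).
  have mG1 := m1 measurableT _ mG; have mG2 := m2 measurableT _ mG.
  rewrite setTI in mG1; rewrite setTI in mG2.
  by apply: measurableU; exact: measurableD.
rewrite (_ : symdiff_indicator = \1_S)//.
apply/funext => -[[u v] z]; rewrite /symdiff_indicator !indicE.
congr ((nat_of_bool _)%:R).
have yE t x : ysection G t x = G (x, t).
  by apply/propext; rewrite /ysection /= inE.
apply/idP/idP => /set_mem h; apply/mem_set; move: h.
  by move=> [[/=]|[/=]]; rewrite !yE => ? ?; [left|right].
by move=> [[/=]|[/=]] ? ?; [left|right]; split; rewrite /= yE.
Qed.

Lemma symdiff_indicator01 z : 0 <= symdiff_indicator z <= 1.
Proof. by rewrite /symdiff_indicator indicE; case: (_ \in _); rewrite /= lexx ler01. Qed.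

Lemma symdiff_indicatorC u v z :
  symdiff_indicator ((u, v), z) = symdiff_indicator ((v, u), z).
Proof. by rewrite /symdiff_indicator/= setYC. Qed.

Variable eta : T -> Lstar X.
Hypothesis G_eta : forall u, exists2 g : Lset X,
  val g = ysection G u & Lclass g = eta u.

Lemma delta_uniform u v :
  delta (eta u) (eta v) = fine (leb X) * \int[P]_w symdiff_indicator ((u, v), Y w).
Proof.
have [a aE <-] := G_eta u; have [b bE <-] := G_eta v.
rewrite delta_Lclass.
(* Elements of [Lset X] are only Lebesgue measurable, but sections of [G] are Borel, as [uniform_on]
   requires. *)
pose B : set (borel_rV R d) := ysection G u `+` ysection G v.
have mB : measurable B.
  by apply: measurableU; apply: measurableD; exact: measurable_ysection.
have -> : \int[P]_w symdiff_indicator ((u, v), Y w) = fine (P (Y @^-1` B)).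
  rewrite /Rintegral -[Y @^-1` B]setIT -integral_indic//.
  by rewrite -[X in measurable X]setTI; exact: measurable_funP.
rewrite Y_unif//= mulrC divfK; last exact: uniform_on_fin.2.
(* The uniform law sees only the part of [B] inside [X]; this is all of [B], both sections being
   values of elements of [Lset X]. *)
congr (fine (leb _)); rewrite aE bE; apply/seteqP; split => z; last by case.
move=> Bz; split => //; move: Bz.
rewrite /B -aE -bE.
by move=> [[+ _]|[+ _]]; exact: Lset_sub.
Qed.

Lemma kset_uniform sigma u v : kset sigma (eta u) (eta v) =
  expR (- (fine (leb X) / (2 * sigma ^+ 2) *
           \int[P]_w symdiff_indicator ((u, v), Y w))).
Proof. by rewrite /kset delta_uniform mulrAC. Qed.

End uniform_law.

(** * Positive definite kernels and products of ANOVA kernels *)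

Section kernels.
Context {R : realType}.

(** The constant 1 contributes the square of the sum of the coefficients to the quadratic form. *)
Lemma kernel_add1 (Z : Type) (K : Z -> Z -> R) :
  is_kernel (fun u z => K u z - 1) -> is_kernel K.
Proof.
move=> [sK pK]; split=> [z z'|n a z].
  by apply: (addIr (- 1)); exact: sK.
have := pK n a z.
have -> : \sum_(i < n) \sum_(j < n) a i * a j * (K (z i) (z j) - 1) =
    \sum_(i < n) \sum_(j < n) a i * a j * K (z i) (z j) - (\sum_(i < n) a i) ^+ 2.
  rewrite expr2 mulr_suml -sumrB; apply: eq_bigr => i _.
  by rewrite mulr_sumr -sumrB; apply: eq_bigr => j _; ring.
by have := sqr_ge0 (\sum_(i < n) a i); lra.
Qed.

Lemma kernel_diag_ge0 (Z : Type) (K : Z -> Z -> R) z : is_kernel K -> 0 <= K z z.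
Proof.
move=> [_ /(_ 1%N (fun=> 1) (fun=> z))].
by rewrite !big_ord1 !mul1r.
Qed.

(** Positive definiteness at the two points [x] and [y], with weights t and 1, is a nonnegative
    quadratic polynomial in t. *)
Lemma kernel_sqr_le (Z : Type) (K : Z -> Z -> R) x y :
  is_kernel K -> K x y ^+ 2 <= K x x * K y y.
Proof.
move=> kK; have [sK pK] := kK.
apply: quadratic_ge0_discr => [|t]; first exact: kernel_diag_ge0.
have := pK 2%N (fun i => if i == ord0 then t else 1)
  (fun i => if i == ord0 then x else y).
rewrite !big_ord_recl !big_ord0 /= (sK y x) => /le_trans; apply.
by rewrite le_eqVlt; apply/orP; left; apply/eqP; ring.
Qed.

End kernels.

Section product_of_anova_kernels.
Context {R : realType} {p : nat} (D : 'I_p -> set R) (D0 : forall i, D i !=set0).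
Context d {Omega : measurableType d} (P : probability Omega R).
Variable U : {RV P >-> inputs D0}.
Hypothesis U_indep : mutually_independent P (fun i w => U w i).
Variables (A : {set 'I_p}) (K : forall i, domain (D0 i) -> domain (D0 i) -> R).
Arguments K i : clear implicits.
Hypothesis K_anova : forall i, anova_kernel (distribution P (component i \o U)) (K i).
Local Notation KA := (product_kernel A K).
Local Notation L1 f := (P.-integrable setT (fun w => (f w)%:E)).

Let kK i : is_kernel (K i).
Proof. by apply: kernel_add1; case: (K_anova i). Qed.

Lemma product_kernelC a b : KA a b = KA b a.
Proof. by apply: eq_bigr => i _; rewrite (kK _).1. Qed.

Lemma product_kernel_diag_ge0 a : 0 <= KA a a.
Proof. by apply: prodr_ge0 => i _; exact: (kernel_diag_ge0 _ (@kK _)). Qed.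

Lemma product_kernel_sqr_le a b : KA a b ^+ 2 <= KA a a * KA b b.
Proof.
rewrite /product_kernel -prodrXl -big_split/=; apply: ler_prod => i _.
by rewrite sqr_ge0/=; exact: (kernel_sqr_le _ _ (@kK _)).
Qed.

Lemma measurable_product_kernel d' (T : measurableType d')
    (f g : T -> subinputs D0 A) :
  measurable_fun setT f -> measurable_fun setT g ->
  measurable_fun setT (fun t => KA (f t) (g t)).
Proof.
move=> mf mg; apply: measurable_prod => i _.
have [mK _ _] := K_anova (sval i).
apply: (measurableT_comp mK (g := fun t => (f t i, g t i))).
have mi := @measurable_component _ _
  (fun i : {i : 'I_p | i \in A} => domain (D0 (sval i))) i.
apply: measurable_fun_pair.
  exact: (measurableT_comp mi mf).
exact: (measurableT_comp mi mg).
Qed.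

Lemma product_kernel_mean (a : subinputs D0 A) :
  \int[P]_w KA a (subvector A (U w)) = 1.
Proof.
pose X (i : 'I_p) : {mfun Omega >-> domain (D0 i)} := component i \o U.
pose Z (i : {i : 'I_p | i \in A}) (z : domain (D0 (sval i))) := K (sval i) (a i) z.
have mZ i : measurable_fun setT (Z i).
  have [mK _ _] := K_anova (sval i).
  apply: (measurableT_comp mK (g := fun z => (a i, z))).
  exact: measurable_fun_pair.
have IZ (i : {i : 'I_p | i \in A}) : L1 (fun w => Z i (X (sval i) w)) /\
    \int[P]_w Z i (X (sval i) w) = 1.
  have [_ _ /(_ (a i))[Ik k0]] := K_anova (sval i).
  have mk : measurable_fun setT (fun z => Z i z - 1) by exact: measurable_funB.
  have Ik' : L1 (fun w => Z i (X (sval i) w) - 1).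
    apply/integrableP; split.
      by apply/measurable_EFinP; exact: (measurableT_comp mk).
    have /integrableP[_] := Ik.
    rewrite (integral_distribution_comp P (X (sval i))
      (f := fun z => `|(Z i z - 1)%:E|%E))//.
    by apply: measurableT_comp => //; exact/measurable_EFinP.
  have k0' : \int[P]_w (Z i (X (sval i) w) - 1) = 0.
    rewrite /Rintegral -(integral_distribution_comp P (X (sval i))
      (f := fun z => (Z i z - 1)%:E)).
      by rewrite k0.
    exact/measurable_EFinP.
  have IZ : L1 (fun w => Z i (X (sval i) w)).
    by have := L1D Ik' (L1_cst P 1); under eq_fun do rewrite subrK.
  split => //; move: k0'; rewrite RintegralB//; last exact: L1_cst.
  by rewrite Rintegral_prob_cst => /eqP; rewrite subr_eq0 => /eqP.
have indA : mutually_independent P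
    (fun i : {i : 'I_p | i \in A} => X (sval i) : _ -> _).
  exact: (mutually_independent_sub (X := fun i w => U w i)).
have [_ E] := independent_Rintegral_prod
  (X := fun i : {i : 'I_p | i \in A} => X (sval i)) (Z := Z)
  indA mZ (index_enum_uniq _) (fun i => (IZ i).1).
apply: (etrans E); apply: big1 => i _; exact: (IZ i).2.
Qed.

End product_of_anova_kernels.

(** * The mean square error *)

Lemma sqr_sub1_le {R : realFieldType} (x y : R) :
  x ^+ 2 <= y -> (x - 1) ^+ 2 <= 2 * y + 2.
Proof. by have := sqr_ge0 (x + 1); nra. Qed.

(* In the theorem the [let]s sit below the coercion [is_true], out of reach  *)
(* of [move=>].                                                              *)
Ltac intro_let y := match goal with |- is_true (let x := ?a in @?b x) =>
  pose (y := a); change (is_true (b y)); cbv beta end.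

Theorem proposition3p4
  (R : realType)
  (* the compact set X of R^d, and sigma *)
  (d : nat) (X : set 'rV[R]_d.+1) (X_compact : compact X)
  (X_pos : (0 < leb X)%E) (sigma : R) (sigma_gt0 : 0 < sigma)
  (* the inputs and the random set *)
  (p : nat) (D : 'I_p -> set R) (D0 : forall i, D i !=set0)
  (dO : measure_display) (Omega : measurableType dO) (P : probability Omega R)
  (U : {RV P >-> inputs D0})
  (U_indep : mutually_independent P (fun i w => U w i))
  (eta : {mfun inputs D0 >-> Lstar X})
  (* the jointly measurable version {(x, u) | x \in eta u} *)
  (G : set (borel_rV R d * inputs D0))
  (G_meas : measurable G)
  (G_eta : forall u, exists2 g : Lset X,
     val g = ysection G u & Lclass g = eta u)
  (* the kernels *)
  (A : {set 'I_p})
  (K : forall i, domain (D0 i) -> domain (D0 i) -> R)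
  (K_anova : forall i, anova_kernel (distribution P (component i \o U)) (K i)) :
  let KA := product_kernel A K in
  forall (H : rkhs (tensor KA (@kset R d X sigma)))
  (KA_int : ('E_P[fun w => KA (subvector A (U w)) (subvector A (U w))] < +oo)%E)
  (* the independent copy U' of U, and Y uniform on X *)
  (U' : {RV P >-> inputs D0})
  (U'_law : same_law P U' U) (U'_indep : independent P U U')
  (Y : {RV P >-> borel_rV R d})
  (Y_unif : uniform_on P X Y)
  (Y_indep : independent P Y (fun w => (U w, U' w)))
  (* the samples *)
  (n m : nat) (n_ge2 : (2 <= n)%N) (m_ge1 : (1 <= m)%N)
  (Us : 'I_n -> {RV P >-> inputs D0})
  (Us_law : forall i, same_law P (Us i) U)
  (Us_indep : mutually_independent P Us)
  (Ys : 'I_m -> {RV P >-> borel_rV R d})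
  (Ys_unif : forall k, uniform_on P X (Ys k))
  (Ys_indep : mutually_independent P Ys)
  (Us_Ys_indep : independent P
     (fun w => (fun i => Us i w) : product_space (fun _ : 'I_n => inputs D0))
     (fun w => (fun k => Ys k w) : product_space (fun _ : 'I_m => borel_rV R d))),
  let L := fine (leb X) / (2 * sigma ^+ 2) in
  let hsic := HSIC P H (subvector A \o U) (eta \o U) in
  let symdiff u u' : set (borel_rV R d) := ysection G u `+` ysection G u' in
  let hsic_hat w : R :=
    2 / (n%:R * (n%:R - 1)) *
    \sum_(i < n) \sum_(j < n | (i < j)%N)
      (KA (subvector A (Us i w)) (subvector A (Us j w)) - 1) *
      expR (- (L * (m%:R^-1 *
        \sum_(k < m) \1_(symdiff (Us i w) (Us j w)) (Ys k w)))) in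
  let KA1 w : R := KA (subvector A (U w)) (subvector A (U' w)) - 1 in
  let h w : R := KA1 w * kset sigma (eta (U w)) (eta (U' w)) in
  let sigma1_sq := 'V_P[h] in
  let sigma2_sq :=
    'V_P[cond_exp P h (fun w => (eta (U w), subvector A (U w)))] in
  let sigma3_sq :=
    'E_P[(fun w => KA1 w ^+ 2 *
       cond_var P (fun w => \1_(symdiff (U w) (U' w)) (Y w))
         (fun w => (subvector A (U w), subvector A (U' w),
                    eta (U w), eta (U' w))) w)%R]%E in
  ('E_P[(fun w => (hsic_hat w - hsic) ^+ 2)%R] <=
   2%:E * ((2 / (n%:R * (n%:R - 1)))%:E * sigma1_sq +
           (4 * (n%:R - 2) / (n%:R * (n%:R - 1)))%:E * sigma2_sq +
           (L ^+ 2 / m%:R)%:E * sigma3_sq))%E.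

Proof.
move=> KA H KA_int U' U'_law U'_indep Y Y_unif Y_indep n m n_ge2 m_ge1 Us Us_law
  Us_indep Ys Ys_unif Ys_indep Us_Ys_indep.
intro_let L; intro_let hsic; intro_let symdiff; intro_let hsic_hat; intro_let KA1.
intro_let h; intro_let sigma1_sq; intro_let sigma2_sq; intro_let sigma3_sq.
pose T := inputs D0.
pose subv : {mfun T >-> subinputs D0 A} := subvector A.
pose q (u : T) := KA (subv u) (subv u).
have mKA d' (Z : measurableType d') (f g : Z -> subinputs D0 A) :
    measurable_fun setT f -> measurable_fun setT g ->
    measurable_fun setT (fun z => KA (f z) (g z)).
  exact: (measurable_product_kernel K_anova).
have KAC a b : KA a b = KA b a by exact: (product_kernelC K_anova).
have KA_diag a : 0 <= KA a a by exact: (product_kernel_diag_ge0 K_anova).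
have KA_sqr a b : KA a b ^+ 2 <= KA a a * KA b b.
  exact: (product_kernel_sqr_le K_anova).
have KA_mean a : \int[P]_w KA a (subv (U w)) = 1.
  exact: (product_kernel_mean U_indep K_anova).
have q_ge0 u : 0 <= q u by exact: KA_diag.
have mq : measurable_fun setT q by exact: mKA.
have Iq : P.-integrable setT (fun w => (q (U w))%:E).
  apply/integrableP; split; first exact/measurable_EFinP/(measurableT_comp mq).
  rewrite (eq_integral (fun w => (q (U w))%:E)).
    by move: KA_int; rewrite unlock.
  by move=> w _; rewrite /= ger0_norm.
have Xfin : (leb X < +oo)%E by have [] := uniform_on_fin Y_unif.
have L0 : 0 <= L.
  by rewrite divr_ge0 ?fine_ge0 ?leb_ge0// mulr_ge0// sqr_ge0.
pose kap (z : T * T) := KA (subv z.1) (subv z.2) - 1.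
pose F := symdiff_indicator G (R := R) (d := d) (T := T).
have mF : measurable_fun setT F by exact: measurable_symdiff_indicator.
have F01 z : 0 <= F z <= 1 by exact: symdiff_indicator01.
have msub1 : measurable_fun setT (fun z : T * T => subv z.1).
  exact: measurableT_comp.
have msub2 : measurable_fun setT (fun z : T * T => subv z.2).
  exact: measurableT_comp.
have mKA1 : measurable_fun setT
    (fun z : subinputs D0 A * subinputs D0 A => KA z.1 z.2 - 1).
  apply: measurable_funB; last exact: measurable_cst.
  exact: (mKA _ _ _ _ measurable_fst measurable_snd).
have mkap : measurable_fun setT kap.
  apply: measurable_funB; last exact: measurable_cst.
  exact: (mKA _ _ _ _ msub1 msub2).
have kapC u v : kap (u, v) = kap (v, u) by rewrite /kap/= KAC.
have FC u v y : F ((u, v), y) = F ((v, u), y) by exact: symdiff_indicatorC.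
pose f := weighted_kernel P Y kap F L.
have ksetE u v : kset sigma (eta u) (eta v) =
    expR (- (L * miss_probability P Y F (u, v))).
  exact: (kset_uniform Y_unif G_meas G_eta).
have hE w : h w = f (U w, U' w) by rewrite /h ksetE.
(* [q (U w) * q (U' w)] is integrable by independence, so the assumption on the diagonal of K_A is
   enough for second moments off the diagonal. *)
have kap_le u v : kap (u, v) ^+ 2 <= 2 * (q u * q v) + 2.
  exact: (sqr_sub1_le (KA_sqr (subv u) (subv v))).
have Iq' : P.-integrable setT (fun w => (q (U' w))%:E).
  by apply: (same_law_L1 (X := U) (f := q)) => // B mB; rewrite U'_law.
have kap2 : P.-integrable setT (fun w => (kap (U w, U' w) ^+ 2)%:E).
  have [Iqq _] := independent_RintegralM U'_indep mq mq Iq Iq'.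
  apply: (L1_dominated _ (L1D (L1Z 2 Iqq) (L1_cst P 2))).
    apply: measurable_funX; apply: (measurableT_comp mkap).
    exact: measurable_fun_pair.
  by move=> w; rewrite ger0_norm ?sqr_ge0.
have kap2x u : P.-integrable setT (fun w => (kap (u, U w) ^+ 2)%:E).
  apply: (L1_dominated _ (L1D (L1Z 2 (L1Z (q u) Iq)) (L1_cst P 2))).
    apply: measurable_funX; apply: (measurableT_comp mkap).
    exact: measurable_fun_pair.
  by move=> w; rewrite ger0_norm ?sqr_ge0.
have mUsc i : measurable_fun setT
    (fun a : product_space (fun _ : 'I_n => T) => a i).
  exact: measurable_component.
have mYsc k : measurable_fun setT
    (fun a : product_space (fun _ : 'I_m => borel_rV R d) => a k).
  exact: measurable_component.
have mUs2 i j := measurable_fun_pair (mUsc i) (mUsc j).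
have mYs2 k l := measurable_fun_pair (mYsc k) (mYsc l).
have UsYs i j k : independent P (pairRV (Us i) (Us j)) (Ys k).
  exact: (independent_comp (mUs2 i j) (mYsc k) Us_Ys_indep).
have UsYs2 i j k l : independent P (pairRV (Us i) (Us j)) (pairRV (Ys k) (Ys l)).
  exact: (independent_comp (mUs2 i j) (mYs2 k l) Us_Ys_indep).
have YsY k : same_law P (Ys k) Y by move=> B mB; rewrite Y_unif// Ys_unif.
have mk2y : measurable_fun setT (fun z : T * T => kset sigma (eta z.1) (eta z.2)).
  rewrite (_ : (fun z => _) = fun z => expR (- (L * miss_probability P Y F z))).
    exact: measurable_expRN_miss_probability.
  by apply/funext => -[u v]; exact: ksetE.
have [mgap hsicE] := hsic_anova (x := subv) (y := eta) U'_indep U'_law H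
  (fun a => mKA _ _ _ _ (measurable_cst a) (@measurable_id _ _ setT))
  (fun g => measurable_kset Xfin sigma g)
  (mKA _ _ _ _ msub1 msub2) mk2y KAC KA_sqr KA_diag
  (kset01 sigma) Iq KA_mean.
pose th := \int[P]_w f (U w, U' w).
have hsicE' : hsic = th.
  apply: (etrans hsicE); apply: eq_Rintegral => w _.
  by rewrite /f /weighted_kernel /= -ksetE.
have hfE : h = (fun w => f (U w, U' w)).
  by apply/funext => w; rewrite /h ksetE.
pose v : {mfun T >-> (Lstar X * subinputs D0 A)%type} := pairRV eta subv.
(* The conditioning pair of sigma_2^2 lists the random set first, the RKHS function lists it second.
   At [v u] this function is the projection of the kernel of the U-statistic. *)
pose gap (z : Lstar X * subinputs D0 A) :=
  embedding_gap P subv eta U KA (kset sigma) (z.2, z.1).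
have mgap' : measurable_fun setT gap.
  apply: (measurableT_comp mgap (g := fun z => (z.2, z.1))).
  exact: measurable_fun_pair.
have gapE u : gap (v u) = \int[P]_w f (u, U w).
  by apply: eq_Rintegral => w _; rewrite /f /weighted_kernel /= -ksetE.
pose v' : {mfun (T * T)%type >-> _} := four_coordinates subv eta.
pose k (z : subinputs D0 A * subinputs D0 A * Lstar X * Lstar X) :=
  (KA z.1.1.1 z.1.1.2 - 1) ^+ 2.
have mk : measurable_fun setT k.
  exact: (measurable_first_coordinates (K := fun z => (KA z.1 z.2 - 1) ^+ 2)
    (measurable_funX _ mKA1)).
have k_ge0 z : 0 <= k z by exact: sqr_ge0.
have bound := nested_estimator_bound U'_indep U'_law n_ge2 m_ge1 Us_law Us_indep
  YsY Ys_indep UsYs UsYs2 mkap mF kapC FC F01 L0 kap2 kap2x (v := v) (v' := v')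
  Y_indep mgap' gapE mk k_ge0 (fun=> erefl).
rewrite /sigma1_sq /sigma2_sq /sigma3_sq hfE hsicE'.
exact: bound.
Qed.
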